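(* Let $K$ be a field of characteristic zero, let $S$ be a numerical semigroup, and let $A=\bigoplus_{i=0}^{D}A_i$ be the associated graded algebra of the Apéry set of $S$. If $A$ is a Complete Intersection, then $A$ satisfies the Quotient Condition. Moreover, the corresponding colon ideal defining $A$ as a quotient of an algebra with the WLP is generated by monomials; that is, there exist a standard graded Gorenstein Artinian $K$-algebra $G$ (presented as a quotient of a polynomial ring over $K$ by a homogeneous ideal) having the WLP, a variable $x_l$ and an integer $C\ge 0$ with $A\cong G/(0:_G x_l^C)$, such that the ideal $(0:_G x_l^C)$ of $G$ is generated by (images of) monomials.
   Context: Let $S=\langle g_1,\ldots,g_n\rangle\subseteq\mathbb N$ be a numerical semigroup with minimal generators $g_1<\cdots<g_n$, $\gcd(g_1,\ldots,g_n)=1$. Let $R=K[t^{g_1},\ldots,t^{g_n}]$, $\overline R=R/t^{g_1}R$, and let $\overline{\mathfrak m}$ be the maximal homogeneous ideal of $\overline R$ (generated by the classes of $t^{g_2},\ldots,t^{g_n}$). The associated graded algebra of the Apéry set of $S$ is $A=\mathrm{gr}_{\overline{\mathfrak m}}(\overline R)=\bigoplus_{i\ge0}\overline{\mathfrak m}^i/\overline{\mathfrak m}^{i+1}$. It is a standard graded Artinian $K$-algebra, $A\cong K[x_2,\ldots,x_n]/I$ with $x_i$ mapping to the class of $t^{g_i}$ in $\overline{\mathfrak m}/\overline{\mathfrak m}^2$; $A$ is a Complete Intersection if $I$ is minimally generated by exactly $n-1$ elements. A standard graded Artinian $K$-algebra $A=\bigoplus_{i=0}^D A_i$ has the Weak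 Lefschetz property (WLP) if there is $L\in A_1$ such that $\times L:A_i\to A_{i+1}$ has maximal rank for every $i=0,\ldots,D-1$. Quotient Condition: a standard graded Gorenstein Artinian $K$-algebra $A$ satisfies it if there exists a standard graded Gorenstein Artinian $K$-algebra $G$ having the WLP such that $A\cong G/(0:_G x_l^C)$ (as graded $K$-algebras) for some linear monomial $x_l$ (the image in $G$ of a variable) and some integer $C\ge0$. (When $C=0$, $A=G$ has the WLP.) *)

(* Defs.v *)
From HB Require Import structures.
From mathcomp Require Import all_boot all_order all_algebra.
From mathcomp Require Export generic_quotient ring_quotient.
From mathcomp.multinomials Require Export mpoly.
From mathcomp Require Import boolp.

Set Implicit Arguments.
Unset Strict Implicit.
Unset Printing Implicit Defensive.

Import GRing.Theory.
Local Open Scope ring_scope.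
Local Open Scope quotient_scope.

(** * Ideals *)

Section Ideals.
Variable B : comNzRingType.
Implicit Types (G : B -> Prop) (m : idealr B).

Definition ideal_gen G (x : B) : Prop :=
  exists s : seq (B * B),
    (forall u, u \in s -> G u.2) /\ x = \sum_(u <- s) u.1 * u.2.

Lemma ideal_gen0 G : ideal_gen G 0.
Proof. by exists [::]; rewrite big_nil. Qed.

Lemma ideal_genS G y : G y -> ideal_gen G y.
Proof.
move=> Gy; exists [:: (1, y)]; rewrite big_seq1 mul1r; split=> // u.
by rewrite inE => /eqP->.
Qed.

Lemma ideal_genM G a x : ideal_gen G x -> ideal_gen G (a * x).
Proof.
move=> [s [Gs ->]]; exists [seq (a * u.1, u.2) | u <- s]; split=> [w|].
  by case/mapP=> u us -> /=; apply: Gs.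
by rewrite big_map mulr_sumr; apply: eq_bigr => u _; rewrite mulrA.
Qed.

Lemma ideal_genD G x y : ideal_gen G x -> ideal_gen G y -> ideal_gen G (x + y).
Proof.
move=> [s [Gs ->]] [t [Gt ->]]; exists (s ++ t); rewrite big_cat; split=> // u.
by rewrite mem_cat => /orP[/Gs|/Gt].
Qed.

Lemma ideal_gen_closed G a x y :
  ideal_gen G x -> ideal_gen G y -> ideal_gen G (a * x + y).
Proof. by move=> Gx Gy; apply: ideal_genD => //; apply: ideal_genM. Qed.

Lemma ideal_gen_sum G (I : Type) (r : seq I) (P : pred I) (F : I -> B) :
  (forall i, P i -> ideal_gen G (F i)) -> ideal_gen G (\sum_(i <- r | P i) F i).
Proof.
move=> GF; elim/big_rec: _ => [|i x Pi Gx]; first exact: ideal_gen0.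
by apply: ideal_genD => //; apply: GF.
Qed.

Lemma ideal_gen_sub G (I : B -> Prop) x :
  I 0 -> (forall a y z, I y -> I z -> I (a * y + z)) -> (forall y, G y -> I y) ->
  ideal_gen G x -> I x.
Proof.
move=> I0 IC GI [s [Gs ->]]; rewrite big_seq.
elim/big_rec: _ => // u y us Iy; apply: IC => //; exact/GI/Gs.
Qed.

Definition ideal_pow m (i : nat) : B -> Prop :=
  ideal_gen (fun y => exists f : 'I_i -> B,
    (forall j, f j \in m) /\ y = \prod_(j < i) f j).

Lemma ideal_pow0 m x : ideal_pow m 0 x.
Proof.
rewrite -[x]mulr1; apply/ideal_genM/ideal_genS.
by exists (fun=> 0); split=> [[]|]; rewrite ?big_ord0.
Qed.

Lemma ideal_pow1 m x : ideal_pow m 1 x <-> x \in m.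
Proof.
split=> [|mx].
  apply: (ideal_gen_sub (I := fun z => z \in m)) => [|a y z my mz|_ [f [mf ->]]].
    exact: rpred0.
    by rewrite rpredD // idealMr.
  by rewrite big_ord1.
by apply: ideal_genS; exists (fun=> x); rewrite big_ord1.
Qed.

Lemma ideal_powM m i j x y :
  ideal_pow m i x -> ideal_pow m j y -> ideal_pow m (i + j) (x * y).
Proof.
move=> mx my; move: mx.
apply: (ideal_gen_sub (I := fun z => ideal_pow m (i + j) (z * y)))
  => [|a u v mu mv|_ [f [mf ->]]].
- by rewrite mul0r; apply: ideal_gen0.
- by rewrite mulrDl -mulrA; apply: ideal_gen_closed.
move: my.
apply: (ideal_gen_sub (I := fun z => ideal_pow m (i + j) (_ * z)))
  => [|a u v mu mv|_ [h [mh ->]]].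
- by rewrite mulr0; apply: ideal_gen0.
- by rewrite mulrDr mulrCA; apply: ideal_gen_closed.
apply: ideal_genS; exists (fun k => match split k with inl k => f k | inr k => h k end).
split=> [k|]; first by case: split.
rewrite big_split_ord; congr (_ * _); apply: eq_bigr => k _.
  by rewrite -[lshift _ _]/(unsplit (inl k)) unsplitK.
by rewrite -[rshift _ _]/(unsplit (inr k)) unsplitK.
Qed.

Lemma ideal_powM_eq m i j k x y : (i + j)%N = k ->
  ideal_pow m i x -> ideal_pow m j y -> ideal_pow m k (x * y).
Proof. by move<-; apply: ideal_powM. Qed.

Lemma ideal_pow_le m i j x : (i <= j)%N -> ideal_pow m j x -> ideal_pow m i x.
Proof.
move=> le_ij; rewrite -(subnKC le_ij).
apply: (ideal_gen_sub (I := ideal_pow m i)) => [|a y z|_ [f [mf ->]]].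
- exact: ideal_gen0.
- exact: ideal_gen_closed.
rewrite big_split_ord /= mulrC; apply/ideal_genM/ideal_genS.
by exists (fun k => f (lshift _ k)).
Qed.

(* [I] is the ideal generated by the finite family [f]. *)
Definition generated_by (I : B -> Prop) (k : nat) (f : 'I_k -> B) : Prop :=
  forall x, I x <-> exists a : 'I_k -> B, x = \sum_(j < k) a j * f j.

Definition min_generated (I : B -> Prop) (k : nat) : Prop :=
  (exists f : 'I_k -> B, generated_by I f) /\
  (forall k' (f : 'I_k' -> B), generated_by I f -> (k <= k')%N).

End Ideals.

(** * Quotients of K-algebras by proper ideals

   MathComp makes [{ideal_quot I}] a commutative ring; we add the K-algebra
   structure. *)

Section QuotientAlgebra.
Variables (K : fieldType) (B : comAlgType K) (I : idealr B).
Local Notation Q := {ideal_quot I}.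

Definition quot_scale (a : K) (x : Q) : Q := \pi_Q (a%:A) * x.

Fact quot_scaleA a b x : quot_scale a (quot_scale b x) = quot_scale (a * b) x.
Proof. by rewrite /quot_scale mulrA -rmorphM -scalerAl mul1r scalerA. Qed.
Fact quot_scale1 : left_id 1 quot_scale.
Proof. by move=> x; rewrite /quot_scale scale1r rmorph1 mul1r. Qed.
Fact quot_scaleDr : right_distributive quot_scale +%R.
Proof. by move=> a x y; rewrite /quot_scale mulrDr. Qed.
Fact quot_scaleDl x : {morph quot_scale^~ x : a b / a + b}.
Proof. by move=> a b; rewrite /quot_scale scalerDl rmorphD mulrDl. Qed.
HB.instance Definition _ := GRing.Zmodule_isLmodule.Build K Q
  quot_scaleA quot_scale1 quot_scaleDr quot_scaleDl.

Fact quot_scaleAl (a : K) (x y : Q) : a *: (x * y) = a *: x * y.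
Proof. exact: mulrA. Qed.
HB.instance Definition _ := GRing.Lmodule_isLalgebra.Build K Q quot_scaleAl.
HB.instance Definition _ := GRing.Lalgebra_isComAlgebra.Build K Q.

Lemma pi_scale a (x : B) : \pi_Q (a *: x) = a *: \pi_Q x.
Proof. by rewrite -[x in LHS]mul1r scalerAl rmorphM. Qed.

End QuotientAlgebra.

(** * Graded algebras *)

Record gradedAlg (K : fieldType) := GradedAlg {
  galg :> comAlgType K;
  gpart : nat -> galg -> Prop
}.

Section GradedAlgebras.
Variable K : fieldType.
Implicit Type A : gradedAlg K.

Definition direct_sum_grading A : Prop :=
  [/\ forall i, gpart i (0 : A),
      forall i a (x y : A), gpart i x -> gpart i y -> gpart i (a *: x + y),
      forall x : A, exists N, exists2 f : nat -> A,
        (forall i, gpart i (f i)) & x = \sum_(i < N) f i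
    & forall N (f : nat -> A), (forall i, gpart i (f i)) ->
        \sum_(i < N) f i = 0 -> forall i, (i < N)%N -> f i = 0].

(* The last clause says that A is generated as a K-algebra by finitely many
   elements of degree 1. *)
Definition standard_graded A : Prop :=
  [/\ direct_sum_grading A,
      forall i j (x y : A), gpart i x -> gpart j y -> gpart (i + j) (x * y),
      forall x : A, gpart 0 x <-> exists c : K, x = c%:A
    & exists m, exists2 v : 'I_m -> A, (forall j, gpart 1 (v j)) &
        forall x : A, exists q : {mpoly K[m]}, x = mmap (in_alg A) v q].

(* A = A_0 + ... + A_D for some D; for a standard graded algebra this is
   finite dimensionality over K. *)
Definition graded_artinian A : Prop :=
  exists D : nat, forall i (x : A), (D < i)%N -> gpart i x -> x = 0.

Definition socle A (x : A) : Prop :=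
  forall i (y : A), (0 < i)%N -> gpart i y -> y * x = 0.

(* For graded Artinian algebras: the socle is a one-dimensional K-space. *)
Definition gorenstein A : Prop :=
  exists2 s : A, s != 0 &
    socle s /\ forall x : A, socle x -> exists c : K, x = c *: s.

Definition std_gorenstein_artinian A : Prop :=
  [/\ standard_graded A, graded_artinian A & gorenstein A].

Definition mul_injective A (L : A) (i : nat) : Prop :=
  forall x : A, gpart i x -> L * x = 0 -> x = 0.

Definition mul_surjective A (L : A) (i : nat) : Prop :=
  forall y : A, gpart i.+1 y -> exists2 x : A, gpart i x & y = L * x.

(* Maximal rank means injective or surjective.  In degrees i >= D the target
   A_{i+1} is zero, so the condition holds automatically there. *)
Definition WLP A : Prop :=
  exists2 L : A, gpart 1 L &
    forall i, mul_injective L i \/ mul_surjective L i.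

Definition graded_iso A A' : Prop :=
  exists2 phi : {lrmorphism A -> A'}, bijective phi &
    forall i (x : A), gpart i x <-> gpart i (phi x).

Definition graded_quot A (J : idealr A) : gradedAlg K :=
  @GradedAlg K {ideal_quot J}
    (fun i x => exists2 y : A, gpart i y & x = \pi_{ideal_quot J} y).

Definition mpoly_graded (m : nat) : gradedAlg K :=
  @GradedAlg K {mpoly K[m]} (fun i q => q \is i.-homog).

Definition homogeneous_ideal (m : nat) (I : idealr {mpoly K[m]}) : Prop :=
  forall i q, q \in I -> pihomog mdeg i q \in I.

End GradedAlgebras.

(** * Associated graded algebras

   The direct sum of the m^i / m^(i+1), written as the quotient of
   { p in B[T] | p_i in m^i } by { p | p_i in m^(i+1) }. *)

Section AssociatedGraded.
Variables (K : fieldType) (B : comAlgType K) (m : idealr B).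

Definition rees_pred : {pred {poly B}} :=
  fun p => `[< forall i, ideal_pow m i p`_i >].

Lemma reesP (p : {poly B}) :
  reflect (forall i, ideal_pow m i p`_i) (p \in rees_pred).
Proof. exact: asboolP. Qed.

Fact rees_subring : subring_closed rees_pred.
Proof.
split=> [|p q /reesP mp /reesP mq|p q /reesP mp /reesP mq]; apply/reesP => i.
- by rewrite coef1; case: i => [|i]; [apply: ideal_pow0|apply: ideal_gen0].
- by rewrite coefB addrC -mulN1r; apply: ideal_gen_closed; [apply: mq|apply: mp].
rewrite coefM; apply: ideal_gen_sum => j _.
by apply: ideal_powM_eq (subnKC (leq_ord j)) _ _.
Qed.
HB.instance Definition _ := GRing.isSubringClosed.Build {poly B} rees_pred
  rees_subring.

Record rees := Rees { rees_val : {poly B}; _ : rees_val \in rees_pred }.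
HB.instance Definition _ := [isSub for rees_val].
HB.instance Definition _ := [Choice of rees by <:].
HB.instance Definition _ := [SubChoice_isSubComNzRing of rees by <:].

Fact rees_scale_subproof (a : K) (p : rees) : a%:A *: val p \in rees_pred.
Proof.
case: p => p /= /reesP mp; apply/reesP => i; rewrite coefZ.
exact/ideal_genM/mp.
Qed.
Definition rees_scale a p : rees := Rees (rees_scale_subproof a p).

Fact rees_scaleA a b p : rees_scale a (rees_scale b p) = rees_scale (a * b) p.
Proof. by apply: val_inj; rewrite /= scalerA -scalerAl mul1r scalerA. Qed.
Fact rees_scale1 : left_id 1 rees_scale.
Proof. by move=> p; apply: val_inj; rewrite /= !scale1r. Qed.
Fact rees_scaleDr : right_distributive rees_scale +%R.
Proof. by move=> a p q; apply: val_inj; rewrite /= scalerDr. Qed.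
Fact rees_scaleDl p : {morph rees_scale^~ p : a b / a + b}.
Proof. by move=> a b; apply: val_inj; rewrite /= !scalerDl. Qed.
HB.instance Definition _ := GRing.Zmodule_isLmodule.Build K rees
  rees_scaleA rees_scale1 rees_scaleDr rees_scaleDl.
Fact rees_scaleAl (a : K) (p q : rees) : a *: (p * q) = a *: p * q.
Proof. by apply: val_inj; rewrite /= scalerAl. Qed.
HB.instance Definition _ := GRing.Lmodule_isLalgebra.Build K rees rees_scaleAl.
HB.instance Definition _ := GRing.Lalgebra_isComAlgebra.Build K rees.

Definition gr_ideal : {pred rees} :=
  fun p => `[< forall i, ideal_pow m i.+1 (val p)`_i >].

Lemma gr_idealP (p : rees) :
  reflect (forall i, ideal_pow m i.+1 (val p)`_i) (p \in gr_ideal).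
Proof. exact: asboolP. Qed.

Fact gr_ideal_closed : idealr_closed gr_ideal.
Proof.
split=> [||a p q /gr_idealP mp /gr_idealP mq].
- by apply/gr_idealP => i; rewrite /= coef0; apply: ideal_gen0.
- apply/negP => /gr_idealP /(_ 0%N).
  by rewrite /= coef1 /= => /ideal_pow1; rewrite idealr1.
apply/gr_idealP => i; rewrite /= coefD; apply: ideal_genD; last exact: mq.
rewrite coefM; apply: ideal_gen_sum => j _.
apply: (@ideal_powM_eq _ _ j (i - j).+1).
- by rewrite addnS subnKC ?leq_ord.
- exact/reesP/(valP a).
- exact: mp.
Qed.
HB.instance Definition _ := isIdealr.Build rees gr_ideal gr_ideal_closed.

Definition gr_alg : comAlgType K := {ideal_quot gr_ideal}.

Definition gr : gradedAlg K :=
  @GradedAlg K gr_alg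
    (fun i x => exists2 p : rees, (forall j, j != i -> (val p)`_j = 0) &
       x = \pi_gr_alg p).

(* The class of b in m^i / m^(i+1) when b is in m^i, and 0 otherwise. *)
Definition gr_class (i : nat) (b : B) : gr :=
  \pi_gr_alg (insubd (0 : rees) (b *: 'X^i)).

Lemma rees_mon i (b : B) : ideal_pow m i b -> b *: 'X^i \in rees_pred.
Proof.
move=> mb; apply/reesP => j; rewrite coefZ coefXn; case: eqP => [->|_].
  by rewrite mulr1.
by rewrite mulr0; apply: ideal_gen0.
Qed.

Lemma gr_class_gpart i b : gpart i (gr_class i b).
Proof.
exists (insubd (0 : rees) (b *: 'X^i)) => // j ji; rewrite val_insubd.
by case: ifP; rewrite ?coef0 // coefZ coefXn (negPf ji) mulr0.
Qed.

Lemma gr_class_eq0 i b :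
  ideal_pow m i b -> gr_class i b = 0 <-> ideal_pow m i.+1 b.
Proof.
move=> mb; have vb := rees_mon mb; rewrite /gr_class.
rewrite -(rmorph0 \pi_gr_alg); split=> [/eqP|mb'].
  rewrite -Quotient.idealrBE subr0 => /gr_idealP/(_ i).
  by rewrite val_insubd vb coefZ coefXn eqxx mulr1.
apply/eqP; rewrite -Quotient.idealrBE subr0; apply/gr_idealP => j.
rewrite val_insubd vb coefZ coefXn; case: eqP => [->|_]; first by rewrite mulr1.
by rewrite mulr0; apply: ideal_gen0.
Qed.

End AssociatedGraded.

(** * Numerical semigroups and the associated graded algebra of the Apéry set *)

(* A numerical semigroup, given by its minimal generators g_1 < ... < g_n:
   n is [nsg_e.+1] and g_1 is [sgen ord0]. *)
Record numSemigroup := NumSemigroup {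
  nsg_e : nat;
  sgen : 'I_nsg_e.+1 -> nat;
  sgen_mono : forall i j : 'I_nsg_e.+1, (i < j)%N -> (sgen i < sgen j)%N;
  sgen_gcd : \big[gcdn/0%N]_i sgen i = 1%N;
  sgen_min : forall (i : 'I_nsg_e.+1) (c : 'I_nsg_e.+1 -> nat),
    c i = 0%N -> sgen i <> (\sum_j c j * sgen j)%N
}.

Lemma sgen_gt0 (S : numSemigroup) (i : 'I_(nsg_e S).+1) : (0 < sgen i)%N.
Proof.
rewrite lt0n; apply/eqP => gi0; apply: (@sgen_min S i (fun=> 0%N)) => //.
by rewrite gi0 big1.
Qed.

Section Apery.
Variables (K : fieldType) (S : numSemigroup).
Local Notation e := (nsg_e S).
Local Notation g := (@sgen S).

(* R = K[t^(g_1), ..., t^(g_n)] as a subalgebra of K[t]. *)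
Definition sgring_pred : {pred {poly K}} :=
  fun p => `[< exists q : {mpoly K[e.+1]}, p = mmap polyC (fun i => 'X^(g i)) q >].

Lemma sgringP (p : {poly K}) :
  reflect (exists q : {mpoly K[e.+1]}, p = mmap polyC (fun i => 'X^(g i)) q)
          (p \in sgring_pred).
Proof. exact: asboolP. Qed.

Fact sgring_closed : subalg_closed sgring_pred.
Proof.
split=> [|a _ _ /sgringP[p ->] /sgringP[q ->]|_ _ /sgringP[p ->] /sgringP[q ->]];
  apply/sgringP.
- by exists 1; rewrite rmorph1.
- by exists (a *: p + q); rewrite rmorphD /= mmapZ mul_polyC.
- by exists (p * q); rewrite rmorphM.
Qed.
HB.instance Definition _ := GRing.isSubalgClosed.Build K {poly K} sgring_pred
  sgring_closed.

Record sgring := SgRing { sgring_val : {poly K}; _ : sgring_val \in sgring_pred }.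
HB.instance Definition _ := [isSub for sgring_val].
HB.instance Definition _ := [Choice of sgring by <:].
HB.instance Definition _ := [SubChoice_isSubComNzRing of sgring by <:].
HB.instance Definition _ := [SubZmodule_isSubLmodule of sgring by <:].
HB.instance Definition _ :=
  [SubNzRing_SubLmodule_isSubLalgebra of sgring by <:].
HB.instance Definition _ := GRing.Lalgebra_isComAlgebra.Build K sgring.

Fact tpow_subproof i : 'X^(g i) \in sgring_pred.
Proof. by apply/sgringP; exists 'X_i; rewrite mmapX mmap1U. Qed.
Definition tpow i : sgring := SgRing (tpow_subproof i).

Lemma tpow_coef0 i : (val (tpow i))`_0 = 0.
Proof. by rewrite /= coefXn; have := sgen_gt0 i; case: (g i). Qed.

Definition tg1_ideal : {pred sgring} :=
  fun a => `[< exists b, a = b * tpow ord0 >].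

Lemma tg1_idealP (a : sgring) :
  reflect (exists b, a = b * tpow ord0) (a \in tg1_ideal).
Proof. exact: asboolP. Qed.

Lemma tg1_coef0 (a : sgring) : a \in tg1_ideal -> (val a)`_0 = 0.
Proof.
by case/tg1_idealP=> b ->; rewrite rmorphM /= coef0M tpow_coef0 mulr0.
Qed.

Fact tg1_ideal_closed : idealr_closed tg1_ideal.
Proof.
split=> [||a _ _ /tg1_idealP[u ->] /tg1_idealP[v ->]].
- by apply/tg1_idealP; exists 0; rewrite mul0r.
- apply/negP => /tg1_coef0; rewrite rmorph1 coef1 => /eqP.
  by rewrite oner_eq0.
- by apply/tg1_idealP; exists (a * u + v); rewrite mulrDl mulrA.
Qed.
HB.instance Definition _ := isIdealr.Build sgring tg1_ideal tg1_ideal_closed.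

Definition sgring_bar : comAlgType K := {ideal_quot tg1_ideal}.

Definition tbar (i : 'I_e.+1) : sgring_bar := \pi_sgring_bar (tpow i).

Definition mbar : {pred sgring_bar} :=
  fun x => `[< ideal_gen (fun y => exists i : 'I_e, y = tbar (lift ord0 i)) x >].

Lemma mbarP (x : sgring_bar) :
  reflect (ideal_gen (fun y => exists i : 'I_e, y = tbar (lift ord0 i)) x)
          (x \in mbar).
Proof. exact: asboolP. Qed.

Lemma mbar_coef0 (a : sgring) : \pi_sgring_bar a \in mbar -> (val a)`_0 = 0.
Proof.
move/mbarP => mx.
suff: exists2 b : sgring, \pi_sgring_bar a = \pi_sgring_bar b & (val b)`_0 = 0.
  case=> b /eqP; rewrite -Quotient.idealrBE => /tg1_coef0.
  by rewrite rmorphB coefB => /eqP; rewrite subr_eq0 => /eqP->.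
apply: (ideal_gen_sub (I := fun x : sgring_bar => exists2 b : sgring,
  x = \pi_sgring_bar b & (val b)`_0 = 0)) mx.
- by exists 0; rewrite ?rmorph0 ?coef0.
- move=> x _ _ [b -> b0] [c -> c0]; exists (repr x * b + c).
    by rewrite rmorphD rmorphM /= reprK.
  by rewrite rmorphD rmorphM /= coefD coef0M b0 c0 mulr0 addr0.
- by move=> _ [i ->]; exists (tpow (lift ord0 i)); rewrite ?tpow_coef0.
Qed.

Fact mbar_closed : idealr_closed mbar.
Proof.
split=> [||a x y /mbarP mx /mbarP my].
- exact/mbarP/ideal_gen0.
- apply/negP; rewrite -(rmorph1 \pi_sgring_bar) => /mbar_coef0.
  by rewrite rmorph1 coef1 => /eqP; rewrite oner_eq0.
- exact/mbarP/ideal_gen_closed.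
Qed.
HB.instance Definition _ := isIdealr.Build sgring_bar mbar mbar_closed.

Definition apery_gr : gradedAlg K := gr mbar.

(* The K-algebra map K[x_2, ..., x_n] -> A sending x_i to the class of t^(g_i)
   in degree one; its kernel is the ideal I with A = K[x_2, ..., x_n] / I. *)
Definition apery_pres (q : {mpoly K[e]}) : apery_gr :=
  mmap (in_alg apery_gr)
       (fun i => gr_class mbar 1 (tbar (lift ord0 i))) q.

Definition apery_complete_intersection : Prop :=
  min_generated (fun q : {mpoly K[e]} => apery_pres q = 0) e.

End Apery.

(** * The Quotient Condition *)

Section QuotientCondition.
Variable K : fieldType.

(* G = K[x_1, ..., x_m] / I *)
Definition poly_alg (m : nat) (I : idealr {mpoly K[m]}) : gradedAlg K :=
  graded_quot (A := mpoly_graded K m) I.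

Definition poly_mon (m : nat) (I : idealr {mpoly K[m]}) (u : 'X_{1..m}) :
  poly_alg I := \pi_(poly_alg I) 'X_[u].

(* A is isomorphic to G / J, where G = K[x_1, ..., x_m] / I is a standard graded
   Gorenstein Artinian algebra with the WLP and J = (0 :_G x_l^C). *)
Definition wlp_colon_quotient (A : gradedAlg K) (m : nat)
    (I : idealr {mpoly K[m]}) (l : 'I_m) (C : nat) (J : idealr (poly_alg I)) :
    Prop :=
  [/\ homogeneous_ideal I,
      std_gorenstein_artinian (poly_alg I),
      WLP (poly_alg I),
      forall y, y \in J <-> y * poly_mon I U_(l) ^+ C = 0
    & graded_iso A (graded_quot J)].

Definition quotient_condition (A : gradedAlg K) : Prop :=
  std_gorenstein_artinian A /\
  exists m (I : idealr {mpoly K[m]}) (l : 'I_m) (C : nat)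
    (J : idealr (poly_alg I)), wlp_colon_quotient A l C J.

Definition monomial_ideal (m : nat) (I : idealr {mpoly K[m]})
    (J : idealr (poly_alg I)) : Prop :=
  exists k (u : 'I_k -> 'X_{1..m}),
    generated_by (fun y => y \in J) (fun j => poly_mon I (u j)).

End QuotientCondition.

(* Main.v *)
(** Write A = K[x_2, ..., x_n] / I.  Grading K[x] by the degree and by the value
    of a monomial in S, every graded piece of A has dimension at most one, so I
    is spanned by monomials and by differences of monomials of equal degree and
    value.  For each variable let a_i be the least exponent such that x_i^(a_i)
    or some x_i^(a_i) - x^(m_i) lies in I, and call this element p_i.  The
    coefficients of the pure powers x_i^(a_i) show that the p_i are independent
    modulo (x) I, so if I has n - 1 generators then I = (p_2, ..., p_n).  For the
    variable x_l of largest value, p_l is the pure power x_l^(a_l).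

    By convexity the rewriting x_i^(a_i) -> x^(m_i) increases the additive weight
    with x_i of weight g_i^2, so it terminates; it is confluent because the
    leading monomials are coprime.  Hence the ideal E_N generated by x_l^N and
    the p_i with i <> l has the obvious monomial basis, multiplication by x_l
    acts on it by shifting, and I = E_(a_l) = (E_(a_l + C) : x_l^C).  The socle
    of K[x] / E_N is spanned by the top basis monomial: multiply an element by
    the complement of its basis monomial of least weight.  Finally
    x_l is a weak Lefschetz element of K[x] / E_N as soon as N is large:
    below degree N it is injective, and from there on every basis monomial is
    divisible by x_l. *)

From HB Require Import structures.
From mathcomp Require Import all_boot all_order all_algebra.
From mathcomp Require Import zify boolp.
From mathcomp.multinomials Require Import ssrcomplements.
Require Import Defs.

Set Implicit Arguments.
Unset Strict Implicit.
Unset Printing Implicit Defensive.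

Import GRing.Theory.
Local Open Scope ring_scope.
Local Open Scope quotient_scope.

(** * Normal forms modulo pure powers minus monomials *)

Section LinearExtension.
Variables (K : fieldType) (n : nat) (V : lmodType K) (F : 'X_{1..n} -> V).

Definition mlin (q : {mpoly K[n]}) : V := \sum_(c <- msupp q) q@_c *: F c.

Lemma mlinwE k q : (msize q <= k)%N ->
  mlin q = \sum_(c : 'X_{1..n < k}) q@_c *: F c.
Proof.
move=> le_qk; pose I : subFinType _ := 'X_{1..n < k}.
rewrite /mlin (big_mksub I) ?msupp_uniq //=; last first.
  by move=> c /msize_mdeg_lt /leq_trans; apply.
by rewrite big_rmcond //= => c /memN_msupp_eq0->; rewrite scale0r.
Qed.

Fact mlin_is_linear : linear mlin.
Proof.
move=> b p q; pose k := maxn (msize (b *: p + q)) (maxn (msize p) (msize q)).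
have [le1 le2 le3] : [/\ msize (b *: p + q) <= k, msize p <= k & msize q <= k]%N.
  by rewrite /k !leq_max !leqnn !orbT.
rewrite !(@mlinwE k) // scaler_sumr -big_split; apply: eq_bigr => c _ /=.
by rewrite mcoeffD mcoeffZ scalerDl scalerA.
Qed.
HB.instance Definition _ :=
  GRing.isLinear.Build K {mpoly K[n]} V *:%R mlin mlin_is_linear.

Lemma mlinX c : mlin 'X_[c] = F c.
Proof. by rewrite /mlin msuppX big_seq1 mcoeffX eqxx scale1r. Qed.

End LinearExtension.

Lemma mpoly_lin_ext (K : fieldType) (n : nat) (V : lmodType K)
    (f g : {linear {mpoly K[n]} -> V}) :
  (forall c, f 'X_[c] = g 'X_[c]) -> f =1 g.
Proof.
move=> fg q; rewrite [q]mpolyE !linear_sum; apply: eq_bigr => c _.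
by rewrite !linearZ fg.
Qed.

Lemma pihomog_mdegX (K : fieldType) (n d : nat) (c : 'X_{1..n}) :
  pihomog mdeg d 'X_[c] = (if mdeg c == d then 'X_[c] else 0) :> {mpoly K[n]}.
Proof. exact: pihomogX. Qed.

(* The relation of the variable [i] is [x_i^(a_i) - x^m], or [x_i^(a_i)] when
   [bs_rule i = None]; the rule of the distinguished variable [bs_var] is never
   applied, its exponent being set by the parameter [N] below. *)
Record binSystem (n : nat) := BinSystem {
  bs_var : 'I_n;
  bs_exp : 'I_n -> nat;
  bs_rule : 'I_n -> option 'X_{1..n};
  bs_wt : 'I_n -> nat;
  bs_exp_gt0 : forall i, (0 < bs_exp i)%N;
  bs_wt_gt0 : forall i, (0 < bs_wt i)%N;
  bs_rule_mdeg : forall i m, bs_rule i = Some m -> mdeg m = bs_exp i;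
  bs_rule_wt : forall i m, bs_rule i = Some m ->
    (bs_exp i * bs_wt i < \sum_j m j * bs_wt j)%N
}.

Section NormalForm.
Variables (K : fieldType) (n : nat) (S : binSystem n).
Local Notation l := (bs_var S).
Local Notation a := (bs_exp S).
Local Notation rule := (bs_rule S).
Local Notation wt := (bs_wt S).
Implicit Types (c u v : 'X_{1..n}) (i j : 'I_n) (N : nat).

(** * Additive weights of monomials *)

Definition mnm_wt c : nat := \sum_j c j * wt j.

Lemma mnm_wtD c u : mnm_wt (c + u)%MM = (mnm_wt c + mnm_wt u)%N.
Proof. by rewrite /mnm_wt -big_split; apply: eq_bigr => j _; rewrite mnmDE mulnDl. Qed.

Lemma mnm_wtXn i k : mnm_wt (U_(i) *+ k)%MM = (k * wt i)%N.
Proof.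
rewrite /mnm_wt (bigD1 i) //= big1 ?addn0 => [|j ji].
  by rewrite mulmnE mnm1E eqxx mul1n.
by rewrite mulmnE mnm1E eq_sym (negPf ji).
Qed.

Lemma mnm_wt_le c : (mnm_wt c <= mdeg c * \sum_j wt j)%N.
Proof.
rewrite mdegE big_distrl; apply: leq_sum => j _; rewrite leq_mul2l.
by rewrite (bigD1 j) //= leq_addr orbT.
Qed.

Lemma lepm_wt_eq c u : (c <= u)%MM -> (mnm_wt u <= mnm_wt c)%N -> c = u.
Proof.
move=> cu le_uc; have cE := submK cu; move: le_uc.
rewrite -{1}cE mnm_wtD -{2}[mnm_wt c]add0n leq_add2r leqn0 => /eqP d0.
suff -> : u = (u - c + c)%MM by apply/mnmP => j; move/eqP: d0;
  rewrite sum_nat_eq0 => /forallP/(_ j); rewrite muln_eq0 => /implyP/(_ isT);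
  rewrite mnmDE => /orP[/eqP->//|/eqP w0]; have := bs_wt_gt0 S j; rewrite w0.
by rewrite cE.
Qed.

(** * Rewriting of monomials: termination and confluence *)

Definition reducible c i := (i != l) && (a i <= c i)%N.
Definition reduced c := forall i, ~~ reducible c i.
Definition reduct i c : option 'X_{1..n} :=
  omap (fun m => c - U_(i) *+ a i + m)%MM (rule i).

Lemma reducible_le c i : reducible c i -> (U_(i) *+ a i <= c)%MM.
Proof.
case/andP=> _ le_ac; apply/mnm_lepP => j; rewrite mulmnE mnm1E.
by case: eqP => [<-|_]; rewrite ?mul1n.
Qed.

Lemma reduct_mdeg c i v : reducible c i -> reduct i c = Some v -> mdeg v = mdeg c.
Proof.
move=> /reducible_le le_ac; rewrite /reduct.
case E: (rule i) => [m|] //= [<-]; rewrite mdegD (bs_rule_mdeg E).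
by rewrite -[in RHS](submK le_ac) mdegD mdegMn mdeg1 mul1n.
Qed.

Lemma reduct_wt c i v : reducible c i -> reduct i c = Some v ->
  (mnm_wt c < mnm_wt v)%N.
Proof.
move=> /reducible_le le_ac; rewrite /reduct.
case E: (rule i) => [m|] //= [<-]; rewrite -[X in (mnm_wt X < _)%N](submK le_ac).
by rewrite !mnm_wtD ltn_add2l mnm_wtXn; apply: bs_rule_wt E.
Qed.

(** Rewriting keeps the degree and raises the weight, which [mnm_wt_le] bounds in terms of the
    degree, so the remaining gap strictly decreases. The successor keeps the fuel positive, so that
    [nf_rec] never stops on a reducible monomial. *)
Definition nf_depth c : nat := (mdeg c * \sum_j wt j - mnm_wt c).+1.

Lemma reduct_depth c i v : reducible c i -> reduct i c = Some v ->
  (nf_depth v < nf_depth c)%N.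
Proof.
move=> ci cv; rewrite /nf_depth -(reduct_mdeg ci cv).
have := reduct_wt ci cv; have := mnm_wt_le v; lia.
Qed.

Fixpoint nf_rec k c : option 'X_{1..n} :=
  if k is k'.+1 then
    if [pick i | reducible c i] is Some i then obind (nf_rec k') (reduct i c)
    else Some c
  else Some c.

(* [None] stands for the zero polynomial. *)
Definition nf c := nf_rec (nf_depth c) c.

Lemma nf_rec_depth k c : (nf_depth c <= k)%N -> nf_rec k c = nf c.
Proof.
rewrite /nf; have: (nf_depth c <= nf_depth c)%N by [].
(* Both fuels become arbitrary bounds on the depth, since after one reduction neither need be the
   exact depth of the new monomial. *)
move: {2 4}(nf_depth c) => k'; elim: k k' c => [|k IHk] [|k'] c //=.
move=> lek lek'; case: pickP => // i ci.
case cv: (reduct i c) => [v|] //=; have ltv := reduct_depth ci cv.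
by apply: IHk; rewrite -ltnS (leq_trans ltv).
Qed.

Lemma nfE c :
  nf c = if [pick i | reducible c i] is Some i then obind nf (reduct i c)
         else Some c.
Proof.
rewrite {1}/nf /nf_depth /=; case: pickP => // i ci.
case cv: (reduct i c) => [v|] //=; apply: nf_rec_depth.
by rewrite -ltnS (leq_trans (reduct_depth ci cv)).
Qed.

Lemma nf_ind (P : 'X_{1..n} -> Prop) :
  (forall c, (forall i v, reducible c i -> reduct i c = Some v -> P v) -> P c) ->
  forall c, P c.
Proof.
move=> IH c; have [k] := ubnP (nf_depth c); elim: k c => // k IHk c lt_ck.
apply: IH => i v ci cv; apply: IHk.
by rewrite (leq_trans (reduct_depth ci cv)).
Qed.

(* Confluence (Newman): distinct rules act on disjoint variables. *)
Lemma nf_reduct c i : reducible c i -> nf c = obind nf (reduct i c).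
Proof.
elim/nf_ind: c i => c IHc i ci; rewrite nfE; case: pickP => [j cj|/(_ i)]; last first.
  by rewrite ci.
have [->//|ij] := eqVneq j i.
have ij' : (i == j) = false by rewrite eq_sym (negPf ij).
(* [w] is what remains of [c] once both leading powers are removed. Either reduction leaves the
   other power in place, so both orders reach the same monomial, or zero when a rule is [None]. *)
pose w := (c - (U_(i) *+ a i + U_(j) *+ a j))%MM.
have cE : c = (w + (U_(i) *+ a i + U_(j) *+ a j))%MM.
  rewrite submK //; apply/mnm_lepP => k; rewrite mnmDE !mulmnE !mnm1E.
  case/andP: ci => _ ci; case/andP: cj => _ cj.
  case: (i =P k) => [<-|_]; first by rewrite (negPf ij) mul1n addn0.
  by case: (j =P k) => [<-|_]; rewrite ?mul1n.
have ri m : rule i = Some m -> reduct i c = Some (w + m + U_(j) *+ a j)%MM.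
  move=> E; rewrite /reduct E /=; congr Some.
  by apply/mnmP => k; rewrite cE !(mnmDE, mnmBE); lia.
have rj m : rule j = Some m -> reduct j c = Some (w + m + U_(i) *+ a i)%MM.
  move=> E; rewrite /reduct E /=; congr Some.
  by apply/mnmP => k; rewrite cE !(mnmDE, mnmBE); lia.
have redE k u : k != l -> reducible (u + U_(k) *+ a k)%MM k.
  by move=> kl; rewrite /reducible kl mnmDE mulmnE mnm1E eqxx mul1n leq_addl.
have rE k u : reduct k (u + U_(k) *+ a k)%MM = omap (fun m => u + m)%MM (rule k).
  by rewrite /reduct; case: (rule k) => //= m; rewrite addmK.
have [il jl] : i != l /\ j != l by case/andP: ci; case/andP: cj.
case Ei: (rule i) => [mi|]; case Ej: (rule j) => [mj|].
- rewrite (ri _ Ei) (rj _ Ej) /=.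
  rewrite (IHc _ _ cj (rj _ Ej) i) ?redE // (IHc _ _ ci (ri _ Ei) j) ?redE //.
  by rewrite !rE Ei Ej /= -!addmA [(mi + _)%MM]addmC.
- rewrite (ri _ Ei) /reduct Ej /=.
  by rewrite (IHc _ _ ci (ri _ Ei) j) ?redE // rE Ej.
- rewrite (rj _ Ej) /reduct Ei /=.
  by rewrite (IHc _ _ cj (rj _ Ej) i) ?redE // rE Ei.
- by rewrite /reduct Ei Ej.
Qed.

Lemma nf_add_rule u i : i != l ->
  nf (u + U_(i) *+ a i)%MM = obind (fun m => nf (u + m)%MM) (rule i).
Proof.
move=> il; rewrite (@nf_reduct _ i); last first.
  by rewrite /reducible il mnmDE mulmnE mnm1E eqxx mul1n leq_addl.
by rewrite /reduct; case: (rule i) => //= m; rewrite addmK.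
Qed.

Lemma nf_reduced c : reduced c -> nf c = Some c.
Proof. by move=> cr; rewrite nfE; case: pickP => // i; rewrite (negPf (cr i)). Qed.

(** Every rewriting step strictly gains weight, so a monomial whose normal form weighs no more was
    never rewritten. This last clause drives the socle computation. *)
Lemma nf_spec c v : nf c = Some v ->
  [/\ reduced v, mdeg v = mdeg c, (mnm_wt c <= mnm_wt v)%N &
      (mnm_wt v <= mnm_wt c)%N -> c = v].
Proof.
elim/nf_ind: c => c IHc; rewrite nfE; case: pickP => [i ci|cr [<-]].
  case cu: (reduct i c) => [u|] //= /(IHc _ _ ci cu) [vr dv le_uv _].
  have lt_cu := reduct_wt ci cu; split=> //.
  - by rewrite dv (reduct_mdeg ci cu).
  - exact: ltnW (leq_trans lt_cu le_uv).
  - by move=> le_vc; have := leq_trans lt_cu (leq_trans le_uv le_vc); rewrite ltnn.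
by split=> // i; rewrite cr.
Qed.

Lemma reducible_add_var c k i : reducible (c + U_(l) *+ k)%MM i = reducible c i.
Proof.
rewrite /reducible mnmDE mulmnE mnm1E; by case: eqVneq => //= il; rewrite addn0.
Qed.

(** Reducibility ignores the exponent of [x_l], and every reduction commutes with multiplication by
    a power of [x_l]. *)
Lemma nf_add_var c k :
  nf (c + U_(l) *+ k)%MM = omap (fun v => v + U_(l) *+ k)%MM (nf c).
Proof.
elim/nf_ind: c => c IHc; case: (pickP (reducible c)) => [i ci|cr].
  rewrite (@nf_reduct _ i) ?reducible_add_var // (nf_reduct ci).
  case cu: (reduct i c) (IHc i) => [u|] IHi.
    have -> : reduct i (c + U_(l) *+ k)%MM = Some (u + U_(l) *+ k)%MM.
      move: cu; rewrite /reduct; case: (rule i) => //= m [<-]; congr Some.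
      have /mnm_lepP le_ac := reducible_le ci.
      by apply/mnmP => j; have := le_ac j; rewrite !(mnmDE, mnmBE); lia.
    exact: IHi.
  by move: cu; rewrite /reduct; case: (rule i).
rewrite !nf_reduced //= => i; first by rewrite cr.
by rewrite reducible_add_var cr.
Qed.

(** * Normal forms of polynomials, and the ideals E_N as kernels *)

Definition nf_mon N c : {mpoly K[n]} :=
  if nf c is Some v then if (v l < N)%N then 'X_[v] else 0 else 0.

Definition nfp N : {mpoly K[n]} -> {mpoly K[n]} := mlin (nf_mon N).
HB.instance Definition _ N := GRing.Linear.on (nfp N).

Lemma nfpX N c : nfp N 'X_[c] = nf_mon N c.
Proof. exact: mlinX. Qed.

Definition bs_rel i : {mpoly K[n]} :=
  'X_[U_(i) *+ a i] - (if rule i is Some m then 'X_[m] else 0).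

Definition bs_gen N (y : {mpoly K[n]}) : Prop :=
  (exists2 i, i != l & y = bs_rel i) \/ y = 'X_[U_(l) *+ N].

Definition bs_ideal N : {mpoly K[n]} -> Prop := ideal_gen (bs_gen N).

(** By linearity [q] may be taken to be a monomial. The two terms of a multiple of [bs_rel] have a
    common normal form by [nf_add_rule]; a multiple of [x_l^N] keeps an exponent of [x_l] at least
    [N] by [nf_add_var], so the truncation in [nf_mon] kills it. *)
Lemma nfp_gen N y q : bs_gen N y -> nfp N (q * y) = 0.
Proof.
case=> [[i il ->]|->]; rewrite [q]mpolyE mulr_suml linear_sum big1 // => c _;
  rewrite -scalerAl linearZ; apply/eqP; rewrite scaler_eq0; apply/orP; right.
  rewrite mulrBr linearB /= -mpolyXD nfpX {1}/nf_mon nf_add_rule //.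
  case: (rule i) => [m|] /=; last by rewrite mulr0 linear0 subr0.
  by rewrite -mpolyXD nfpX subrr.
rewrite -mpolyXD /= nfpX /nf_mon nf_add_var; case: (nf c) => //= v.
by rewrite mnmDE mulmnE mnm1E eqxx mul1n ltnNge leq_addl.
Qed.

Lemma nfp_ideal N y : bs_ideal N y -> nfp N y = 0.
Proof.
case=> s [Gs ->]; rewrite big_seq linear_sum big1 // => u us.
exact/nfp_gen/Gs.
Qed.

Lemma nf_congr N c : bs_ideal N ('X_[c] - nf_mon N c).
Proof.
elim/nf_ind: c => c IHc; rewrite /nf_mon nfE; case: pickP => [i ci|cr]; last first.
  case: ifP => [_|cl]; first by rewrite subrr; apply: ideal_gen0.
  have cE : ((c - U_(l) *+ N) + U_(l) *+ N)%MM = c.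
    rewrite submK //; apply/mnm_lepP => j; rewrite mulmnE mnm1E.
    by case: eqP => [<-|//]; rewrite mul1n leqNgt cl.
  by rewrite subr0 -cE mpolyXD; apply/ideal_genM/ideal_genS; right.
have il : i != l by case/andP: ci.
have cE := submK (reducible_le ci).
have Erel : bs_ideal N ('X_[c - U_(i) *+ a i] * bs_rel i).
  by apply/ideal_genM/ideal_genS; left; exists i.
case cu: (reduct i c) => [u|] /=; last first.
  move: Erel cu; rewrite /bs_rel /reduct; case: (rule i) => // + _.
  by rewrite subr0 -mpolyXD cE subr0.
move/(_ _ _ ci cu): IHc; rewrite /nf_mon => Eu.
move: Erel cu; rewrite /bs_rel /reduct; case: (rule i) => //= m.
rewrite mulrBr -!mpolyXD cE => Erel [uE]; move: Erel; rewrite uE => Erel.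
by have := ideal_genD Erel Eu; rewrite addrA subrK.
Qed.

Lemma nfp_congr N q : bs_ideal N (q - nfp N q).
Proof.
rewrite {1}[q]mpolyE /nfp {1}/mlin -sumrB; apply: ideal_gen_sum => c _.
by rewrite -scalerBr -mul_mpolyC; apply/ideal_genM/nf_congr.
Qed.

(** [nfp] vanishes on the ideal and moves a polynomial only within its class. Hence the reduced
    monomials with exponent of [x_l] below [N] form a basis of the quotient. *)
Lemma bs_idealP N q : bs_ideal N q <-> nfp N q = 0.
Proof.
split=> [|q0]; first exact: nfp_ideal.
by have := nfp_congr N q; rewrite q0 subr0.
Qed.

Lemma nf_mon_coeff N c v : (nf_mon N c)@_v = ((nf c == Some v) && (v l < N)%N)%:R.
Proof.
rewrite /nf_mon; case: (nf c) => [u|]; last by rewrite mcoeff0.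
rewrite (inj_eq (@Some_inj _)).
case: ifP; rewrite (mcoeffX, mcoeff0); case: (u =P v) => //= -> -> //.
Qed.

Lemma nfp_coeff N q v : (nfp N q)@_v =
  \sum_(c <- msupp q) q@_c * ((nf c == Some v) && (v l < N)%N)%:R.
Proof.
rewrite /nfp /mlin linear_sum; apply: eq_bigr => c _.
by rewrite /= mcoeffZ nf_mon_coeff.
Qed.

Lemma nfp_supp N q v : v \in msupp (nfp N q) ->
  [/\ reduced v, (v l < N)%N & exists2 c, c \in msupp q & nf c = Some v].
Proof.
rewrite mcoeff_msupp nfp_coeff => nz.
have [c cq /negP nzc] : exists2 c, c \in msupp q &
    ~ (q@_c * ((nf c == Some v) && (v l < N)%N)%:R == 0).
  apply: contrapT => none; case/eqP: nz; rewrite big_seq big1 // => c cq.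
  by apply/eqP/negPn/negP => nzc; apply: none; exists c => //; apply/negP.
have : (nf c == Some v) && (v l < N)%N.
  by apply: contraR nzc => /negPf->; rewrite mulr0.
case/andP=> /eqP cv vl; split=> //; last by exists c.
by case: (nf_spec cv).
Qed.

Lemma nfp_homog N d q : q \is d.-homog -> nfp N q \is d.-homog.
Proof.
move=> /dhomogP hq; apply/dhomogP => v /nfp_supp[_ _ [c cq cv]].
by case: (nf_spec cv) => _ dv _ _; rewrite -(hq _ cq).
Qed.

Lemma nfp_pihomog N d q : nfp N (pihomog mdeg d q) = pihomog mdeg d (nfp N q).
Proof.
move: q; apply: (@mpoly_lin_ext _ _ _ (nfp N \o pihomog mdeg d)
                                      (pihomog mdeg d \o nfp N)) => c /=.
rewrite pihomog_mdegX nfpX /nf_mon.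
case cv: (nf c) => [v|]; last by case: ifP; rewrite !linear0 ?nfpX // /nf_mon cv.
have [_ dv _ _] := nf_spec cv.
case: ifP => dc; case: ifP => vl.
- by rewrite nfpX /nf_mon cv vl pihomog_mdegX dv dc.
- by rewrite nfpX /nf_mon cv vl linear0.
- by rewrite linear0 pihomog_mdegX dv dc.
- by rewrite !linear0.
Qed.

Lemma nfp_reduced N v : reduced v -> (v l < N)%N -> nfp N 'X_[v] = 'X_[v].
Proof. by move=> vr vl; rewrite nfpX /nf_mon nf_reduced // vl. Qed.

Lemma nfp_mul_var N k q :
  nfp (N + k) ('X_l ^+ k * q) = 'X_l ^+ k * nfp N q.
Proof.
rewrite mpolyXn; set x := 'X_[_].
rewrite [q]mpolyE mulr_sumr !linear_sum mulr_sumr; apply: eq_bigr => c _ /=.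
rewrite -scalerAr !linearZ -scalerAr; congr (_ *: _).
rewrite /x -mpolyXD addmC /= !nfpX /nf_mon nf_add_var.
case: (nf c) => [v|] /=; last by rewrite mulr0.
rewrite mnmDE mulmnE mnm1E eqxx mul1n ltn_add2r.
by case: ifP => _; rewrite ?mulr0 // addmC mpolyXD.
Qed.

(** Multiplication by [x_l^k] is injective on polynomials and only shifts normal forms; this is the
    colon formula (E_(N+k) : x_l^k) = E_N. *)
Lemma bs_ideal_mul_var N k q : bs_ideal (N + k) ('X_l ^+ k * q) <-> bs_ideal N q.
Proof.
rewrite !bs_idealP nfp_mul_var; split=> [/eqP|->]; last by rewrite mulr0.
by rewrite mulf_eq0 mpolyXn -msupp_eq0 msuppX /= => /eqP.
Qed.

End NormalForm.

(** * Algebras presented by such relations *)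

Lemma idealr_of_closed (R : comNzRingType) (P : R -> Prop) :
  P 0 -> ~ P 1 -> (forall b x y, P x -> P y -> P (b * x + y)) ->
  exists I : idealr R, forall x, x \in I <-> P x.
Proof.
move=> P0 P1 PD; pose I : {pred R} := fun x => `[< P x >].
have IC : idealr_closed I.
  split=> [||b x y /asboolP Px /asboolP Py]; apply/asboolP => //.
  exact: PD.
pose m := isIdealr.Build R I IC.
pose J : idealr R := HB.pack I m.
by exists J => x; split=> /asboolP.
Qed.

Lemma lrmorphism_ex (K : fieldType) (B A : comAlgType K) (f : B -> A) :
  {morph f : p q / p + q} -> {morph f : p q / p * q} -> f 1 = 1 ->
  (forall b p, f (b *: p) = b *: f p) ->
  exists g : {lrmorphism B -> A}, g =1 f.
Proof.
move=> fD fM f1 fZ.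
have fB : additive f.
  move=> p q; rewrite fD; congr (_ + _).
  by rewrite -scaleN1r fZ scaleN1r.
have fM' : multiplicative f by split.
pose mB := GRing.isAdditive.Build _ _ f fB.
pose mM := GRing.isMultiplicative.Build _ _ f fM'.
pose mZ := GRing.isScalable.Build _ _ _ _ f fZ.
pose g : {lrmorphism B -> A} := HB.pack f mB mM mZ.
by exists g.
Qed.

Lemma quot_pi_eq0 (R : comNzRingType) (I : idealr R) (x : R) :
  \pi_{ideal_quot I} x = 0 <-> x \in I.
Proof.
rewrite -[X in X \in I]subr0 Quotient.idealrBE.
by rewrite -[X in _ = X](rmorph0 \pi_{ideal_quot I}); split=> [->|/eqP].
Qed.

Lemma quot_pi_lrmorphism (K : fieldType) (B : comAlgType K) (I : idealr B) :
  exists f : {lrmorphism B -> {ideal_quot I}}, f =1 \pi_{ideal_quot I}.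
Proof.
apply: lrmorphism_ex => [p q|p q||b p].
- exact: rmorphD.
- exact: rmorphM.
- exact: rmorph1.
- exact: pi_scale.
Qed.

(** Composing [g] with a section of [f] works: equal kernels make the result independent of the
    section, hence a morphism, and a section of [g] yields the inverse. *)
Lemma lrmorphism_factor (K : fieldType) (B A A' : comAlgType K)
    (f : {lrmorphism B -> A}) (g : {lrmorphism B -> A'}) :
  (forall x, exists q, x = f q) -> (forall x, exists q, x = g q) ->
  (forall q, f q = 0 <-> g q = 0) ->
  exists2 phi : {lrmorphism A -> A'}, bijective phi & forall q, phi (f q) = g q.
Proof.
move=> /choice[rf rfK] /choice[rg rgK] fg.
have fgE p q : f p = f q <-> g p = g q.
  split=> /eqP; rewrite -subr_eq0 -rmorphB => /eqP/fg/eqP;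
    by rewrite rmorphB subr_eq0 => /eqP.
have gr q : g (rf (f q)) = g q by apply/fgE.
have frg q : f (rg (g q)) = f q by apply/fgE.
have [phi phiE] : exists phi : {lrmorphism A -> A'}, phi =1 (g \o rf).
  apply: lrmorphism_ex => [x y|x y||b x] /=.
  - have [+ _] := fgE (rf (x + y)) (rf x + rf y).
    by rewrite !rmorphD /= -!rfK; apply.
  - have [+ _] := fgE (rf (x * y)) (rf x * rf y).
    by rewrite !rmorphM /= -!rfK; apply.
  - by have [+ _] := fgE (rf 1) 1; rewrite !rmorph1 -rfK; apply.
  - have [+ _] := fgE (rf (b *: x)) (b *: rf x).
    by rewrite !linearZ /= -!rfK; apply.
have phif q : phi (f q) = g q by rewrite phiE /= gr.
exists phi => //; exists (f \o rg) => x /=.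
  by rewrite [x]rfK phif frg.
by rewrite phif -rgK.
Qed.

Section Presentations.
Variables (K : fieldType) (n : nat).
Local Notation B := {mpoly K[n]}.

Definition presents (A : gradedAlg K) (f : {lrmorphism B -> A}) (P : B -> Prop) :=
  [/\ forall x : A, exists q, x = f q, forall q, f q = 0 <-> P q
    & forall i (x : A), gpart i x <-> exists2 q, q \is i.-homog & x = f q].

Variable S : binSystem n.
Local Notation l := (bs_var S).
Local Notation a := (bs_exp S).
Local Notation E := (@bs_ideal K n S).

Section Properties.
Variables (A : gradedAlg K) (f : {lrmorphism B -> A}) (N : nat).
Hypotheses (fA : presents f (E N)) (N_gt0 : (0 < N)%N).

Lemma presents_nfp q : f q = f (nfp S N q).
Proof.
have [_ f0 _] := fA; apply/eqP; rewrite -subr_eq0 -rmorphB; apply/eqP/f0.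
exact: nfp_congr.
Qed.

Lemma presents_standard : standard_graded A.
Proof.
have [fs f0 fg] := fA; split.
- split=> [i|i b _ _ /fg[p hp ->] /fg[q hq ->]|x|k y yg ys i lt_ik].
  + by apply/fg; exists 0; rewrite ?rpred0 ?rmorph0.
  + by apply/fg; exists (b *: p + q); rewrite ?rpredD ?rpredZ // linearP.
  + have [q ->] := fs x; exists (msize q); exists (fun i => f (pihomog mdeg i q)).
      by move=> i; apply/fg; exists (pihomog mdeg i q); rewrite // pihomogP.
    by rewrite -rmorph_sum -pihomog_partitionE.
  have /choice[q qE] : forall i, exists q, q \is i.-homog /\ y i = f q.
    by move=> j; have /fg[q] := yg j; exists q.
  have : f (\sum_(j < k) q j) = 0.
    by rewrite rmorph_sum -[RHS]ys; apply: eq_bigr => j _; rewrite (qE j).2.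
  (* The kernel is homogeneous because [nfp] commutes with [pihomog], so a vanishing sum has
     vanishing components. *)
  move/f0/bs_idealP => s0; rewrite (qE i).2; apply/f0/bs_idealP.
  have <- : pihomog mdeg i (\sum_(j < k) q j) = q i.
    rewrite linear_sum (bigD1 (Ordinal lt_ik)) //= pihomog_dE ?(qE i).1 //.
    rewrite big1 ?addr0 // => j /eqP ji; apply: (pihomog_ne0 _ (qE j).1).
    by apply/eqP => jE; apply: ji; apply: val_inj.
  by rewrite nfp_pihomog s0 linear0.
- move=> i j _ _ /fg[p hp ->] /fg[q hq ->]; apply/fg; exists (p * q).
    exact: dhomogM.
  by rewrite rmorphM.
- move=> x; split=> [/fg[q /dhomogP hq ->]|[b ->]].
    exists q@_0%MM; suff {1}-> : q = (q@_0%MM)%:A by rewrite linearZ /= rmorph1.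
    rewrite alg_mpolyC; apply/mpolyP => c; rewrite mcoeffC.
    case: eqP => [->|/eqP c0]; first by rewrite mulr1.
    rewrite mulr0; apply/eqP; rewrite mcoeff_eq0; apply/negP => /hq dc.
    by case/negP: c0; rewrite -mdeg_eq0; apply/eqP.
  apply/fg; exists b%:A; last by rewrite linearZ /= rmorph1.
  by rewrite rpredZ // dhomog1.
- exists n, (fun j => f 'X_j) => [j|x].
    by apply/fg; exists 'X_j => //; rewrite dhomogX; apply/eqP/mdeg1.
  have [q ->] := fs x; exists q; rewrite /mmap {1}[q]mpolyE linear_sum.
  apply: eq_bigr => c _; rewrite linearZ /= mulr_algl; congr (_ *: _).
  by rewrite mpolyXE_id rmorph_prod; apply: eq_bigr => j _; rewrite rmorphXn.
Qed.

(** The basis monomial that all others divide; its class will span the socle. *)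
Definition bs_top : 'X_{1..n} := [multinom (if i == l then N else a i).-1 | i < n].

Lemma bs_top_reduced : reduced S bs_top.
Proof.
move=> i; rewrite /reducible mnmE; case: eqP => //= _.
by rewrite -ltnNge; case: (a i) (bs_exp_gt0 S i).
Qed.

Lemma bs_top_var : (bs_top l < N)%N.
Proof. by rewrite mnmE eqxx; case: N N_gt0. Qed.

Lemma reduced_le_top v : reduced S v -> (v l < N)%N -> (v <= bs_top)%MM.
Proof.
move=> vr vl; apply/mnm_lepP => j; rewrite mnmE.
case: eqP => [->|/eqP jl]; first by case: N vl.
have := vr j; rewrite /reducible jl /= -ltnNge.
by case: (a j).
Qed.

Lemma presents_artinian : graded_artinian A.
Proof.
have [fs f0 fg] := fA; exists (mdeg bs_top) => i x lt_i /fg[q hq ->].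
apply/f0/bs_idealP/eqP; rewrite -msupp_eq0 -size_eq0 -leqn0 leqNgt.
apply/negP => /(mem_nth 0%MM); set v := nth _ _ _ => vq.
have /dhomogP/(_ _ vq) dv := nfp_homog S N hq.
have [vr vl _] := nfp_supp vq.
have := submK (reduced_le_top vr vl) => /(congr1 (@mdeg n)); rewrite mdegD.
by move: dv lt_i => /= ->; lia.
Qed.

Lemma presents_gorenstein : gorenstein A.
Proof.
have [fs f0 fg] := fA; exists (f 'X_[bs_top]).
  apply/eqP => /f0/bs_idealP; rewrite (nfp_reduced _ bs_top_reduced bs_top_var).
  by move/eqP; rewrite -msupp_eq0 msuppX.
split=> [i y i_gt0 /fg[q hq ->]|x sx].
  rewrite -rmorphM; apply/f0/bs_idealP/eqP; rewrite -msupp_eq0 -size_eq0 -leqn0 leqNgt.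
  apply/negP => /(mem_nth 0%MM); set v := nth _ _ _ => vq.
  have hp : q * 'X_[bs_top] \is (i + mdeg bs_top).-homog.
    by apply: dhomogM => //; rewrite dhomogX.
  have /dhomogP/(_ _ vq) dv := nfp_homog S N hp.
  have [vr vl _] := nfp_supp vq.
  have := submK (reduced_le_top vr vl) => /(congr1 (@mdeg n)); rewrite mdegD.
  by move: dv => /= ->; lia.
have [q [xE q_supp]] : exists q, x = f q /\ forall u, u \in msupp q ->
    reduced S u /\ (u l < N)%N.
  have [q0 ->] := fs x; exists (nfp S N q0); split; first exact: presents_nfp.
  by move=> u /nfp_supp[].
have [q_0|q_nz] := eqVneq q 0.
  by exists 0; rewrite xE q_0 rmorph0 scale0r.
have ex_k : exists k, has (fun v => mnm_wt S v == k) (msupp q).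
  exists (mnm_wt S (mlead q)); apply/hasP; exists (mlead q) => //.
  exact: mlead_supp.
case: (ex_minnP ex_k) => k /hasP[v vq /eqP vk] kmin.
have vmin u : u \in msupp q -> (mnm_wt S v <= mnm_wt S u)%N.
  by move=> uq; rewrite vk; apply: kmin; apply/hasP; exists u.
have le_top u : u \in msupp q -> (u <= bs_top)%MM.
  by move=> /q_supp[ur ul]; apply: reduced_le_top.
(* If the lightest monomial is the top one, every other monomial divides the top without being
   lighter, so [q] is a multiple of the top monomial. *)
have [v_top|v_top] := eqVneq v bs_top.
  exists q@_bs_top; rewrite xE -linearZ; congr (f _).
  rewrite {1}[q]mpolyE (bigD1_seq bs_top) ?msupp_uniq -?v_top //=.
  rewrite big_seq_cond big1 ?addr0 // => u /andP[uq /eqP[]].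
  rewrite v_top; apply: (lepm_wt_eq (le_top _ uq)); rewrite -v_top; exact: vmin.
pose w := (bs_top - v)%MM.
have wv : (w + v = bs_top)%MM by apply: submK; apply: le_top.
have : f 'X_[w] * x = 0.
  apply: (sx (mdeg w)); last by apply/fg; exists 'X_[w]; rewrite ?dhomogX.
  rewrite lt0n mdeg_eq0; apply: contraNneq v_top => w0.
  by rewrite -wv w0 add0m.
(* The coefficient of the top monomial in the normal form of [w q] turns out to be that of [v] in
   [q], which is nonzero. *)
rewrite xE -rmorphM => /f0/bs_idealP/(congr1 (mcoeff bs_top)).
rewrite mcoeff0 {1}[q]mpolyE mulr_sumr (linear_sum (nfp S N)) (linear_sum (mcoeff bs_top))
  (bigD1_seq v) ?msupp_uniq //=.
rewrite -scalerAr linearZ mcoeffZ -mpolyXD /= wv (nfp_reduced _ bs_top_reduced bs_top_var).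
rewrite mcoeffX eqxx mulr1 big_seq_cond big1 ?addr0 => [/eqP|u /andP[uq uv]].
  by rewrite mcoeff_eq0 vq.
(* If [w u] has the top as normal form, it weighs at least as much as [w v], which is the top
   itself; by [nf_spec] it was not rewritten, so [u = v]. *)
rewrite -scalerAr linearZ mcoeffZ -mpolyXD /= nfpX nf_mon_coeff.
case: eqP => [wu|]; last by rewrite mulr0.
case: (nf_spec wu) => _ _ _ wtE; case/eqP: uv; apply: (@addmI _ w).
rewrite wv; apply: wtE; rewrite -wv !mnm_wtD leq_add2l.
exact: vmin.
Qed.

Lemma presents_std : std_gorenstein_artinian A.
Proof.
split; [exact: presents_standard|exact: presents_artinian|].
exact: presents_gorenstein.
Qed.

Lemma presents_WLP : (\sum_j a j < N)%N -> WLP A.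
Proof.
move=> lt_aN; have [fs f0 fg] := fA; exists (f 'X_l).
  by apply/fg; exists 'X_l => //; rewrite dhomogX; apply/eqP/mdeg1.
move=> i; have [lt_iN|le_Ni] := ltnP i.+1 N; [left=> x|right=> y].
  (* Cancelling [x_l] lands in E_(N-1). In degree [i < N - 1] no exponent of [x_l] reaches [N - 1],
     so truncating at [N - 1] or at [N] gives the same normal form. *)
  case/fg=> q hq -> /=; rewrite -rmorphM => /f0; rewrite -(subnK N_gt0).
  rewrite -[X in X * _]expr1 bs_ideal_mul_var => /bs_idealP q0.
  apply/f0/bs_idealP; rewrite -[RHS]q0 /nfp /mlin big_seq [RHS]big_seq.
  apply: eq_bigr => c cq; congr (_ *: _); rewrite /nf_mon.
  case cv: (nf S c) => [v|] //; have [_ dv _ _] := nf_spec cv.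
  have vi : (v l <= i)%N.
    have /dhomogP/(_ _ cq)/= <- := hq; rewrite -dv mdegE (bigD1 l) //=.
    exact: leq_addr.
  by rewrite !ifT //; lia.
case/fg=> q hq ->; rewrite presents_nfp.
have hp := nfp_homog S N hq; move: (nfp S N q) (@nfp_supp K n S N q) hp => p ps hp.
(* A reduced monomial free of [x_l] has degree at most the sum of the [a_j], which is below [N] and
   so below [i + 1]. *)
have p_var v : v \in msupp p -> (U_(l) <= v)%MM.
  move=> vp; have [vr _ _] := ps v vp; rewrite lep1mP; apply/eqP => vl0.
  have /dhomogP/(_ _ vp)/= dv := hp.
  suff : (mdeg v <= \sum_j a j)%N by rewrite dv; lia.
  rewrite mdegE; apply: leq_sum => j _; have := vr j; rewrite /reducible.
  by case: eqVneq => [->|_] /=; [rewrite vl0|lia].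
pose r : {mpoly K[n]} := \sum_(v <- msupp p) p@_v *: 'X_[v - U_(l)].
exists (f r).
  apply/fg; exists r => //; rewrite /r big_seq; apply: rpred_sum => v vp.
  apply: rpredZ; rewrite dhomogX; apply/eqP.
  have /dhomogP/(_ _ vp)/= := hp; rewrite -[in mdeg v](submK (p_var v vp)).
  by rewrite mdegD mdeg1 addn1 => -[].
rewrite -rmorphM; congr (f _); rewrite {1}[p]mpolyE /r mulr_sumr.
rewrite big_seq [RHS]big_seq; apply: eq_bigr => v vp.
by rewrite -scalerAr -mpolyXD addmC (submK (p_var v vp)).
Qed.

End Properties.

Lemma poly_alg_presents (I : idealr B) (f : {lrmorphism B -> {ideal_quot I}}) :
  f =1 \pi_{ideal_quot I} ->
  @presents (poly_alg I) f (fun q => q \in I).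
Proof.
move=> fE; split=> [x|q|i x].
- by exists (repr x); rewrite fE reprK.
- by rewrite fE; apply: quot_pi_eq0.
- by split=> [[q hq ->]|[q hq ->]]; exists q; rewrite ?fE.
Qed.

Lemma bs_ideal_proper N : (0 < N)%N -> ~ E N 1.
Proof.
move=> N_gt0 /bs_idealP; rewrite -mpolyX0 nfp_reduced ?mnm0E //.
  by move/eqP; rewrite -msupp_eq0 msuppX.
by move=> i; rewrite /reducible mnm0E leqNgt bs_exp_gt0 andbF.
Qed.

Theorem presents_wlp_colon_quotient (A : gradedAlg K) (f : {lrmorphism B -> A}) :
  presents f (E (a l)) ->
  exists (I : idealr B) (C : nat) (J : idealr (poly_alg I)),
    wlp_colon_quotient A l C J /\ monomial_ideal J.
Proof.
move=> fA; have [fs f0 fg] := fA.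
(* This [C] puts [N] above the bound of [presents_WLP], and E_(a_l) is the colon of E_N by
   [x_l^C]. *)
pose C := (\sum_j a j).+1; pose N := (a l + C)%N.
have N_gt0 : (0 < N)%N by rewrite /N addnS.
have [I IE] : exists I : idealr B, forall x, x \in I <-> E N x.
  apply: idealr_of_closed; [exact: ideal_gen0|exact: bs_ideal_proper|].
  by move=> b x y; apply: ideal_gen_closed.
have [p pE] := quot_pi_lrmorphism I.
have pI := poly_alg_presents pE.
have pN : @presents (poly_alg I) p (E N).
  by case: pI => ps p0 pg; split=> // q; rewrite p0 IE.
have XE : poly_mon I U_(l) ^+ C = p ('X_l ^+ C).
  by rewrite rmorphXn /= pE.
have pJ q : p q * p ('X_l ^+ C) = 0 <-> E (a l) q.
  rewrite -rmorphM mulrC; case: pN => _ -> _; exact: bs_ideal_mul_var.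
have [J JE] : exists J : idealr (poly_alg I),
    forall y, y \in J <-> y * poly_mon I U_(l) ^+ C = 0.
  apply: idealr_of_closed => [||b x y x0 y0]; rewrite ?XE ?mul0r //.
    rewrite -(rmorph1 p) => /pJ; exact: bs_ideal_proper (bs_exp_gt0 S l).
  by rewrite XE in x0 y0; rewrite mulrDl -mulrA x0 y0 mulr0 addr0.
exists I, C, J; split; first split=> //.
- by move=> i q /IE/bs_idealP q0; apply/IE/bs_idealP; rewrite nfp_pihomog q0 linear0.
- exact: presents_std pN N_gt0.
- by apply: (presents_WLP pN N_gt0); rewrite /N /C; lia.
(* [r \o p] and [f] are surjections from the polynomial ring with the same kernel E_(a_l). *)
- have [r rE] := quot_pi_lrmorphism J.
  have rpJ q : r (p q) = 0 <-> E (a l) q.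
    by rewrite rE -pJ -XE; split=> [/quot_pi_eq0/JE|?] //; apply/quot_pi_eq0/JE.
  pose g : {lrmorphism B -> {ideal_quot J}} := r \o p.
  have [phi phi_bij phiE] : exists2 phi : {lrmorphism A -> {ideal_quot J}},
      bijective phi & forall q, phi (f q) = g q.
    apply: lrmorphism_factor => // [x|q]; last by rewrite f0 /= rpJ.
    by case: pI => /(_ (repr x))[q qE] _ _; exists q; rewrite /= -qE rE reprK.
  exists phi => // i x; split=> [/fg[q hq ->]|[y [q hq yE] phix]].
    exists (p q); last by rewrite phiE /= rE.
    by exists q; rewrite // pE.
  apply/fg; exists q => //; apply: (bij_inj phi_bij).
  by rewrite phix yE phiE /= rE pE.
(* Apart from [x_l^(a_l)], the generators of E_(a_l) already lie in E_N, so the colon ideal is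
   generated by that single monomial. *)
exists 1%N, (fun=> U_(l) *+ a l)%MM => y; rewrite JE XE.
have mE : poly_mon I (U_(l) *+ a l)%MM = p 'X_[U_(l) *+ a l] by rewrite pE.
split=> [|[b ->]]; last first.
  rewrite big_ord1 -mulrA mE; suff -> : p 'X_[U_(l) *+ a l] * p ('X_l ^+ C) = 0.
    by rewrite mulr0.
  by apply/pJ/ideal_genS; right.
have [q ->] : exists q, y = p q by case: pI => /(_ y).
move=> /pJ Eq.
suff [b [z [Ez ->]]] : exists b z, E N z /\ q = b * 'X_[U_(l) *+ a l] + z.
  have pz : p z = 0 by case: pN => _ p0 _; apply/p0.
  by exists (fun=> p b); rewrite big_ord1 mE rmorphD rmorphM /= pz addr0.
move: Eq; apply: (ideal_gen_sub (I := fun q => exists b z, E N z /\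
  q = b * 'X_[U_(l) *+ a l] + z))
  => [|h _ _ [b [z [Ez ->]]] [b' [z' [Ez' ->]]]|t].
- by exists 0, 0; split; [exact: ideal_gen0|rewrite mul0r addr0].
- exists (h * b + b'), (h * z + z'); split; first exact: ideal_gen_closed.
  by rewrite mulrDr mulrDl mulrA addrACA.
case=> [[i il ->]|->]; last first.
  by exists 1, 0; split; [exact: ideal_gen0|rewrite mul1r addr0].
exists 0, (bs_rel K S i); split; last by rewrite mul0r add0r.
by apply: ideal_genS; left; exists i.
Qed.

End Presentations.

(** * Complete intersections spanned by binomials *)

Section PresentationIdeal.
Variables (K : fieldType) (n : nat) (g : 'I_n -> nat) (l : 'I_n).
Local Notation B := {mpoly K[n]}.
Implicit Types (c m : 'X_{1..n}) (i j : 'I_n) (P : B -> Prop).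

Definition mnm_val c : nat := \sum_j c j * g j.

Lemma mnm_valXn i k : mnm_val (U_(i) *+ k)%MM = (k * g i)%N.
Proof.
rewrite /mnm_val (bigD1 i) //= big1 ?addn0 => [|j ji].
  by rewrite mulmnE mnm1E eqxx mul1n.
by rewrite mulmnE mnm1E eq_sym (negPf ji).
Qed.

Lemma mdegXn i k : mdeg (U_(i) *+ k : 'X_{1..n})%MM = k.
Proof. by rewrite mdegMn mdeg1 mul1n. Qed.

Lemma mnm_other_var m i k : mdeg m = k -> m <> (U_(i) *+ k)%MM ->
  exists2 j, j != i & (0 < m j)%N.
Proof.
move=> dm m_k; apply: contrapT => none; apply: m_k.
have m0 j : j != i -> m j = 0%N.
  by move=> ji; apply/eqP; rewrite -leqn0 leqNgt; apply/negP => mj; apply: none; exists j.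
apply/mnmP => j; rewrite mulmnE mnm1E; case: eqP => [<-|/eqP ij]; last first.
  by rewrite m0 // eq_sym.
rewrite mul1n -dm mdegE (bigD1 i) //= big1 ?addn0 // => j' /m0 //.
Qed.

Hypothesis g_inj : injective g.

(* By strict convexity of the square. *)
Lemma mnm_val_square m i k : mdeg m = k -> mnm_val m = (k * g i)%N ->
  m <> (U_(i) *+ k)%MM -> (k * g i ^ 2 < \sum_j m j * g j ^ 2)%N.
Proof.
move=> dm vm /(mnm_other_var dm)[j0 j0i m_j0].
have le2 j : (m j * (2 * (g i * g j)) <= m j * (g i ^ 2 + g j ^ 2))%N.
  by rewrite leq_mul2l nat_Cauchy orbT.
have : (\sum_j m j * (2 * (g i * g j)) < \sum_j m j * (g i ^ 2 + g j ^ 2))%N.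
  rewrite (bigD1 j0) //= [X in (_ < X)%N](bigD1 j0) //= -addSn leq_add //.
    rewrite ltn_pmul2l // ltn_neqAle !nat_Cauchy andbT.
    by apply: contraNneq j0i => /g_inj->.
  by apply: leq_sum => j _; apply: le2.
have -> : (\sum_j m j * (2 * (g i * g j)) = 2 * (k * g i ^ 2))%N.
  rewrite -mulnn [(k * _)%N]mulnA -vm /mnm_val big_distrl big_distrr /=.
  by apply: eq_bigr => j _; lia.
have -> : (\sum_j m j * (g i ^ 2 + g j ^ 2) = k * g i ^ 2 + \sum_j m j * g j ^ 2)%N.
  rewrite -dm mdegE big_distrl -big_split; apply: eq_bigr => j _ /=.
  by rewrite mulnDr.
lia.
Qed.

Hypotheses (g_gt0 : forall i, (0 < g i)%N) (g_max : forall i, (g i <= g l)%N).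

(** A factor other than [x_l] would make the value strictly smaller. Hence the relation of the
    largest variable can only be a pure power. *)
Lemma mnm_val_max m k : mdeg m = k -> mnm_val m = (k * g l)%N ->
  m = (U_(l) *+ k)%MM.
Proof.
move=> dm vm; apply: contrapT => /(mnm_other_var dm)[j jl m_j].
have lt_gj : (g j < g l)%N.
  by rewrite ltn_neqAle g_max andbT; apply: contraNneq jl => /g_inj->.
suff : (mnm_val m < k * g l)%N by rewrite vm ltnn.
rewrite -dm mdegE big_distrl /mnm_val (bigD1 j) //= [X in (_ < X)%N](bigD1 j) //=.
rewrite -addSn leq_add ?ltn_pmul2l //; apply: leq_sum => i _.
by rewrite leq_mul2l g_max orbT.
Qed.

(** * Least relations of the variables in a complete intersection ideal *)

Variables (P : B -> Prop) (f : 'I_n -> B).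
Hypotheses (P_gen : generated_by P f) (P1 : ~ P 1).
Hypothesis P_homog : forall d q, P q -> P (pihomog mdeg d q).
Hypothesis P_binomial : forall q c, P q -> c \in msupp q ->
  P 'X_[c] \/ exists m, [/\ m <> c, mdeg m = mdeg c, mnm_val m = mnm_val c
                          & P ('X_[c] - 'X_[m])].
Hypothesis P_nil : forall i, exists k, P 'X_[U_(i) *+ k].

Let P_closed b x y : P x -> P y -> P (b * x + y).
Proof.
move=> /P_gen[u ->] /P_gen[v ->]; apply/P_gen; exists (fun j => b * u j + v j).
by rewrite mulr_sumr -big_split; apply: eq_bigr => j _; rewrite mulrDl mulrA.
Qed.

Let P0 : P 0.
Proof. by apply/P_gen; exists (fun=> 0); rewrite big1 // => j _; rewrite mul0r. Qed.

Let reduct_spec i k (r : option 'X_{1..n}) : Prop :=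
  if r is Some m then
    [/\ m <> (U_(i) *+ k)%MM, mdeg m = k, mnm_val m = (k * g i)%N
      & P ('X_[U_(i) *+ k] - 'X_[m])]
  else P 'X_[U_(i) *+ k].

(** Minimality passes to all of [P]: if [x_i^k] occurred in some element of [P], [P_binomial] would
    turn it into a relation with exponent [k]. *)
Let least_reduct i : exists kr : nat * option 'X_{1..n},
  [/\ (0 < kr.1)%N, reduct_spec i kr.1 kr.2
    & forall q k, P q -> (k < kr.1)%N -> q@_(U_(i) *+ k) = 0].
Proof.
have ex : exists k, `[< exists r, reduct_spec i k r >].
  by have [k Pk] := P_nil i; exists k; apply/asboolP; exists None.
case: (ex_minnP ex) => k /asboolP[r kr] kmin; exists (k, r); split=> //=.
  (* Exponent zero would put 1 in [P], or require a monomial of degree zero other than 1. *)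
  rewrite lt0n; apply/eqP => k0; move: kr; rewrite k0 /reduct_spec.
  case: r => [m|]; rewrite mulm0n ?mpolyX0 //.
  by case=> m0 /eqP; rewrite mdeg_eq0 => /eqP.
move=> q k' Pq lt_k'; apply/eqP; rewrite mcoeff_eq0; apply/negP => cq.
suff /kmin : `[< exists r, reduct_spec i k' r >] by rewrite leqNgt lt_k'.
apply/asboolP; case: (P_binomial Pq cq) => [Pc|[m [mc dm vm Pm]]]; first by exists None.
by exists (Some m); split=> //; rewrite ?dm ?vm ?mdegXn ?mnm_valXn.
Qed.

(** Divisors of a pure power are pure powers, and the lower ones are absent from [q]; so only the
    constant term of [b] contributes. *)
Lemma mcoeffM_pure i k (b q : B) :
  (forall k', (k' < k)%N -> q@_(U_(i) *+ k') = 0) ->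
  (b * q)@_(U_(i) *+ k) = b@_0%MM * q@_(U_(i) *+ k).
Proof.
move=> q0; rewrite [b]mpolyE mulr_suml !linear_sum mulr_suml.
apply: eq_bigr => c _; rewrite -scalerAl /= !mcoeffZ mcoeffX -mulrA; congr (_ * _).
have [->|c0] := eqVneq c 0%MM; first by rewrite mpolyX0 !mul1r.
rewrite mul0r; case c_le: (c <= (U_(i) *+ k))%MM.
  rewrite -{1}(submK c_le) addmC mulrC mcoeffMX.
  have -> : (U_(i) *+ k - c)%MM = (U_(i) *+ (k - c i))%MM.
    have /mnm_lepP c_le' := c_le; apply/mnmP => j; have := c_le' j.
    by rewrite mnmBE !mulmnE !mnm1E; case: eqP => [->|] /=; lia.
  apply: q0; have := congr1 (@mdeg n) (submK c_le); rewrite mdegD mdegXn.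
  have : c i = mdeg c.
    have /mnm_lepP c_le' := c_le; rewrite mdegE (bigD1 i) //= big1 ?addn0 // => j ji.
    by have := c_le' j; rewrite mulmnE mnm1E eq_sym (negPf ji); lia.
  by move: c0; rewrite -mdeg_eq0; lia.
rewrite mulrC [q]mpolyE mulr_suml linear_sum big1 // => m _.
rewrite -scalerAl /= mcoeffZ -mpolyXD mcoeffX; case: eqP => [mE|]; last by rewrite mulr0.
by rewrite -mE lem_addl in c_le.
Qed.

Lemma pihomogM_homog d (b q : B) : q \is d.-homog ->
  pihomog mdeg d (b * q) = b@_0%MM *: q.
Proof.
move=> hq; rewrite [b]mpolyE mulr_suml !linear_sum scaler_suml.
apply: eq_bigr => c _; rewrite -scalerAl linearZ /= mcoeffZ mcoeffX -scalerA.
congr (_ *: _); have [->|c0] := eqVneq c 0%MM.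
  by rewrite mpolyX0 mul1r scale1r pihomog_dE.
rewrite scale0r (@pihomog_ne0 _ _ _ (mdeg c + d)) //; last first.
  by apply: dhomogM => //; rewrite dhomogX.
by rewrite -mdeg_eq0 in c0; lia.
Qed.

(* The residues of the binomials [bs_rel] modulo the irrelevant ideal times P
   are independent, since reading off the coefficients of the pure powers gives
   the identity matrix; as P has n generators they generate P up to a
   determinant with nonzero constant term, which homogeneity removes. *)
Theorem binomial_ci_presentation :
  exists S : binSystem n, bs_var S = l /\
    forall q, P q <-> bs_ideal S (bs_exp S l) q.
Proof.
have [kr krP] := choice least_reduct.
pose a i := (kr i).1; pose rule i := (kr i).2.
have a_gt0 i : (0 < a i)%N by case: (krP i).
have rule_deg i m : rule i = Some m -> mdeg m = a i.
  by case: (krP i) => _ + _ rE; rewrite -/(rule i) rE => -[].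
have rule_val i m : rule i = Some m -> mnm_val m = (a i * g i)%N.
  by case: (krP i) => _ + _ rE; rewrite -/(rule i) rE => -[].
have rule_neq i m : rule i = Some m -> m <> (U_(i) *+ a i)%MM.
  by case: (krP i) => _ + _ rE; rewrite -/(rule i) rE => -[].
have rule_wt i m : rule i = Some m -> (a i * g i ^ 2 < \sum_j m j * g j ^ 2)%N.
  by move=> rE; apply: mnm_val_square;
    [apply: rule_deg rE|apply: rule_val rE|apply: rule_neq rE].
have g2_gt0 i : (0 < g i ^ 2)%N by rewrite expn_gt0 g_gt0.
pose S := @BinSystem n l a rule (fun i => g i ^ 2)%N a_gt0 g2_gt0 rule_deg rule_wt.
exists S; split=> //= q.
have rule_l : rule l = None.
  case rE: (rule l) => [m|] //; case: (rule_neq _ _ rE).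
  by apply: mnm_val_max; [apply: rule_deg rE|apply: rule_val rE].
pose p i := bs_rel K S i.
have Pp i : P (p i).
  rewrite /p /bs_rel /=; case: (krP i) => _ + _; rewrite -/(rule i) -/(a i).
  by case: (rule i) => [m []|] //=; rewrite ?subr0 //.
have pl : p l = 'X_[U_(l) *+ a l] by rewrite /p /bs_rel /= rule_l subr0.
have Ep i : bs_ideal S (a l) (p i).
  apply: ideal_genS; have [->|il] := eqVneq i l; first by right.
  by left; exists i.
have p_coeff i j : (p i)@_(U_(j) *+ a j) = (i == j)%:R.
  rewrite /p /bs_rel mcoeffB mcoeffX /=.
  have -> : ((U_(i) *+ a i)%MM == (U_(j) *+ a j)%MM :> 'X_{1..n}) = (i == j).
    apply/eqP/eqP => [/mnmP/(_ i)|->] //; rewrite !mulmnE !mnm1E eqxx eq_sym.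
    by case: eqP => // _; have := a_gt0 i; lia.
  case rE: (rule i) => [m|]; last by rewrite mcoeff0 subr0.
  (* A right-hand side equal to [x_j^(a_j)] has the degree and the value of [x_i^(a_i)]; hence
     [i = j], which [rule_neq] excludes. *)
  rewrite mcoeffX; case: (m =P _) => [mE|_]; last by rewrite subr0.
  have aE : a i = a j by rewrite -(rule_deg _ _ rE) mE mdegXn.
  have gE : g i = g j.
    apply/eqP; have := rule_val _ _ rE; rewrite mE mnm_valXn aE => /eqP.
    by rewrite eqn_pmul2l // eq_sym.
  by case: (rule_neq _ _ rE); rewrite mE (g_inj gE).
have f_coeff j i k : (k < a i)%N -> (f j)@_(U_(i) *+ k) = 0.
  case: (krP i) => _ _ lt0 lt_k; apply: lt0 => //; apply/P_gen.
  exists (fun j' => (j' == j)%:R); rewrite (bigD1 j) //= eqxx mul1r big1 ?addr0 //.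
  by move=> j' /negPf->; rewrite mul0r.
split=> [Pq|]; last first.
  apply: ideal_gen_sub => // y [[i _ ->]|->]; first exact: Pp.
  by rewrite -pl.
have /choice[b bE] : forall i, exists b : 'I_n -> B, p i = \sum_j b j * f j.
  by move=> i; apply/P_gen.
pose M := \matrix_(i, j) b i j; pose D := \det M.
(* Comparing the coefficients of the pure powers in p = M f shows that the constant terms of [M]
   form an invertible matrix. *)
have D0 : D@_0%MM != 0.
  have : map_mx (mcoeff 0%MM) M *m (\matrix_(j, i) (f j)@_(U_(i) *+ a i)) = 1%:M.
    apply/matrixP => i k; rewrite !mxE -p_coeff bE linear_sum /=.
    apply: eq_bigr => j _; rewrite !mxE mcoeffM_pure // => k'; exact: f_coeff.
  move/mulmx1_unit => [+ _]; rewrite unitmxE det_map_mx unitfE.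
  by [].
(* The adjugate of [M] turns p = M f into D f = adj(M) p. *)
have Df j : bs_ideal S (a l) (D * f j).
  have -> : D * f j = \sum_i (\adj M) j i * p i.
    have := mul_adj_mx M => /(congr1 (fun X => (X *m \col_j f j) j ord0)).
    rewrite -mulmxA mul_scalar_mx mxE [RHS]mxE [X in _ = _ * X]mxE => DE.
    rewrite /D -DE; apply: eq_bigr => i _; congr (_ * _); rewrite mxE bE.
    by apply: eq_bigr => k _; rewrite !mxE.
  by apply: ideal_gen_sum => i _; apply/ideal_genM/Ep.
have Dq x : P x -> bs_ideal S (a l) (D * x).
  move/P_gen => [u ->]; rewrite mulr_sumr; apply: ideal_gen_sum => j _.
  by rewrite mulrCA; apply/ideal_genM/Df.
(* For a homogeneous component of degree [d], the degree [d] part of its product with [D] is the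
   component times the constant term of [D], a nonzero scalar that can be cancelled. *)
rewrite (pihomog_partitionE (leqnn (msize q))); apply: ideal_gen_sum => d _.
have := Dq _ (P_homog d Pq) => /bs_idealP/(congr1 (pihomog mdeg d)).
rewrite -nfp_pihomog pihomogM_homog ?pihomogP // linearZ linear0 => /eqP.
rewrite scaler_eq0 (negPf D0) => /eqP q0; exact/bs_idealP.
Qed.

End PresentationIdeal.

(** * The ideal of the associated graded algebra of the Apéry set *)

Section AperyPresentation.
Variables (K : fieldType) (S : numSemigroup).
Local Notation e := (nsg_e S).
Local Notation g := (@sgen S).
Local Notation R := (sgring K S).
Local Notation Rbar := (sgring_bar K S).
Local Notation mx := (@mbar K S).
Local Notation pib := (\pi_(sgring_bar K S)).
Local Notation g' := (fun j : 'I_e => g (lift ord0 j)).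
Implicit Types (r : R) (k s : nat) (c : 'X_{1..e}).

(** * Powers of the maximal ideal in terms of exponents *)

Definition sg_sum (u : 'I_e.+1 -> nat) : nat := \sum_i u i * g i.
Definition sg_ord (u : 'I_e.+1 -> nat) : nat := \sum_(j < e) u (lift ord0 j).

(* The exponents [s] with [t^s] in [(t^(g_1)) + m^k]. *)
Definition sg_deep k s : Prop :=
  exists2 u, s = sg_sum u & (0 < u ord0)%N \/ (k <= sg_ord u)%N.

Lemma sg_sumD u v : sg_sum (fun i => u i + v i)%N = (sg_sum u + sg_sum v)%N.
Proof. by rewrite /sg_sum -big_split; apply: eq_bigr => i _; rewrite mulnDl. Qed.

Lemma sg_deepD k k' s s' : sg_deep k s -> sg_deep k' s' -> sg_deep (k + k') (s + s').
Proof.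
move=> [u -> ku] [v -> kv]; exists (fun i => u i + v i)%N; first by rewrite sg_sumD.
case: ku => [u0|ku]; first by left; rewrite addn_gt0 u0.
case: kv => [v0|kv]; first by left; rewrite addn_gt0 v0 orbT.
by right; rewrite /sg_ord big_split leq_add.
Qed.

Lemma sgring_coef r s : (val r)`_s != 0 -> sg_deep 0 s.
Proof.
case: r => p /= /sgringP[q ->]; rewrite /mmap coef_sum => nz.
have [c /negP nzc] : exists c : 'X_{1..e.+1},
    ~ ((q@_c)%:P * mmap1 (fun i => 'X^(g i)) c)`_s == 0.
  apply: contrapT => none; case/eqP: nz; apply: big1 => c _.
  by apply/eqP/negPn/negP => nzc; apply: none; exists c; apply/negP.
move: nzc; rewrite coefCM mulf_eq0 negb_or => /andP[_].
have -> : mmap1 (fun i => 'X^(g i)) c = 'X^(sg_sum c) :> {poly K}.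
  by rewrite /mmap1 /sg_sum -prodrXr; apply: eq_bigr => i _; rewrite -exprM mulnC.
rewrite coefXn; case: (s =P _) => [-> _|]; last by rewrite eqxx.
by exists c; last by right.
Qed.

Definition deep_supp k r : Prop := forall s, (val r)`_s != 0 -> sg_deep k s.

Lemma deep_suppM k k' r r' : deep_supp k r -> deep_supp k' r' ->
  deep_supp (k + k') (r * r').
Proof.
move=> kr kr' s; rewrite rmorphM coefM => nz.
have [i /negP] : exists i : 'I_s.+1, ~ ((val r)`_i * (val r')`_(s - i) == 0).
  apply: contrapT => none; case/eqP: nz; apply: big1 => i _.
  by apply/eqP/negPn/negP => nzi; apply: none; exists i; apply/negP.
rewrite mulf_eq0 negb_or => /andP[/kr ri /kr' rj].
by rewrite -(subnKC (leq_ord i)); apply: sg_deepD.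
Qed.

Lemma deep_suppD k r r' : deep_supp k r -> deep_supp k r' -> deep_supp k (r + r').
Proof.
move=> kr kr' s; rewrite rmorphD coefD; have [r0|/kr//] := eqVneq (val r)`_s 0.
by rewrite r0 add0r; apply: kr'.
Qed.

Lemma deep_supp0 k : deep_supp k 0.
Proof. by move=> s; rewrite rmorph0 coef0 eqxx. Qed.

Lemma deep_suppMl k r r' : deep_supp k r' -> deep_supp k (r * r').
Proof. by apply: (@deep_suppM 0); exact: sgring_coef. Qed.

Lemma deep_supp_sum k (I : Type) (t : seq I) (F : I -> R) :
  (forall i, deep_supp k (F i)) -> deep_supp k (\sum_(i <- t) F i).
Proof.
move=> kF; elim/big_rec: _ => [|i x _ kx]; first exact: deep_supp0.
exact: deep_suppD.
Qed.

Lemma deep_suppZ k (b : K) r : deep_supp k r -> deep_supp k (b *: r).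
Proof. by move=> kr; rewrite -mulr_algl; apply: deep_suppMl. Qed.

Definition tmon (u : 'I_e.+1 -> nat) : R := \prod_i tpow K i ^+ u i.

Lemma val_sgringZ (b : K) r : val (b *: r) = b *: val r.
Proof. by []. Qed.

Lemma val_sgring_sum (I : Type) (t : seq I) (F : I -> R) :
  val (\sum_(i <- t) F i) = \sum_(i <- t) val (F i) :> {poly K}.
Proof. exact: rmorph_sum. Qed.

Lemma val_tmon u : val (tmon u) = 'X^(sg_sum u) :> {poly K}.
Proof.
rewrite /tmon rmorph_prod /sg_sum -prodrXr; apply: eq_bigr => i _.
by rewrite rmorphXn /= -exprM mulnC.
Qed.

Lemma deep_supp_tmon k u : (0 < u ord0)%N \/ (k <= sg_ord u)%N ->
  deep_supp k (tmon u).
Proof.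
move=> ku s; rewrite val_tmon coefXn; case: (s =P _) => [-> _|]; last by rewrite eqxx.
by exists u.
Qed.

Lemma tpow_tmon i : tpow K i = tmon (fun j => (i == j)%:R).
Proof.
apply: val_inj; rewrite val_tmon /=; congr 'X^_.
rewrite /sg_sum (bigD1 i) //= eqxx mul1n big1 ?addn0 // => j ji.
by rewrite eq_sym (negPf ji).
Qed.

Lemma pib_tpow0 : pib (tpow K ord0) = 0.
Proof. by apply/quot_pi_eq0/tg1_idealP; exists 1; rewrite mul1r. Qed.

(** Representatives differ by a multiple of [t^(g_1)], which is deep to every order by the first
    alternative in [sg_deep]. *)
Lemma pib_deep k r r' : pib r = pib r' -> deep_supp k r' -> deep_supp k r.
Proof.
move=> rr' kr'; rewrite -[r](subrK r'); apply: deep_suppD => //.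
have /quot_pi_eq0/tg1_idealP[b ->] : pib (r - r') = 0 by rewrite rmorphB /= rr' subrr.
by apply: deep_suppMl; rewrite tpow_tmon; apply: deep_supp_tmon; left; rewrite eqxx.
Qed.

Let deep_closed k x y z :
  (exists2 r, y = pib r & deep_supp k r) -> (exists2 r, z = pib r & deep_supp k r) ->
  exists2 r, x * y + z = pib r & deep_supp k r.
Proof.
move=> [r -> kr] [r' -> kr']; exists (repr x * r + r').
  by rewrite rmorphD rmorphM /= reprK.
by apply: deep_suppD => //; apply: deep_suppMl.
Qed.

Lemma mbar_deep x : x \in mx -> exists2 r, x = pib r & deep_supp 1 r.
Proof.
move/mbarP; apply: (ideal_gen_sub (I := fun y => exists2 r, y = pib r & deep_supp 1 r))
  => [|x' y z|y [i ->]].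
- by exists 0; [rewrite rmorph0|apply: deep_supp0].
- exact: deep_closed.
exists (tpow K (lift ord0 i)) => //; rewrite tpow_tmon; apply: deep_supp_tmon; right.
by rewrite /sg_ord (bigD1 i) //= eqxx.
Qed.

Lemma ideal_pow_deep k x : ideal_pow mx k x -> exists2 r, x = pib r & deep_supp k r.
Proof.
apply: (ideal_gen_sub (I := fun y => exists2 r, y = pib r & deep_supp k r))
  => [|x' y z|y [f [mf ->]]].
- by exists 0; [rewrite rmorph0|apply: deep_supp0].
- exact: deep_closed.
elim: k f mf => [|k IHk] f mf.
  by rewrite big_ord0; exists 1; [rewrite rmorph1|apply: sgring_coef].
rewrite big_ord_recl; have [r -> kr] := IHk _ (fun i => mf (lift ord0 i)).
have [r' -> kr'] := mbar_deep (mf ord0); exists (r' * r); first by rewrite rmorphM.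
exact: (deep_suppM kr' kr).
Qed.

Lemma ideal_pow_tmon u : ideal_pow mx (sg_ord u) (pib (tmon u)).
Proof.
rewrite /tmon big_ord_recl rmorphM; apply: ideal_genM; rewrite rmorph_prod /sg_ord.
elim/big_rec2: _ => [|j x k _ IH]; first exact: ideal_pow0.
apply: ideal_powM => //; rewrite rmorphXn /=.
elim: (u _) => [|k' IHk]; first exact: ideal_pow0.
rewrite exprS -add1n; apply: ideal_powM => //.
by apply/ideal_pow1/mbarP/ideal_genS; exists j.
Qed.

Lemma pib_tmon0 u : (0 < u ord0)%N -> pib (tmon u) = 0.
Proof.
move=> u0; rewrite /tmon big_ord_recl rmorphM rmorphXn /=.
by rewrite pib_tpow0 -(prednK u0) exprS !mul0r.
Qed.

Lemma deep_decomp k r : deep_supp k r -> exists u : nat -> 'I_e.+1 -> nat,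
  (forall s, (val r)`_s != 0 -> (0 < u s ord0)%N \/ (k <= sg_ord (u s))%N) /\
  r = \sum_(s < size (val r)) (val r)`_s *: tmon (u s).
Proof.
move=> kr; have /choice[u uP] : forall s, exists u, (val r)`_s != 0 ->
    s = sg_sum u /\ ((0 < u ord0)%N \/ (k <= sg_ord u)%N).
  move=> s; have [r0|nz] := eqVneq (val r)`_s 0; first by exists (fun=> 0%N).
  by have [u] := kr s nz; exists u.
exists u; split=> [s /uP[] //|]; apply: val_inj; rewrite -[LHS]coefK poly_def.
rewrite val_sgring_sum; apply: eq_bigr => s _; rewrite val_sgringZ val_tmon.
have [->|/uP[<- _] //] := eqVneq (val r)`_s 0.
by rewrite !scale0r.
Qed.

(** Membership can be tested on exponents alone: each term of a deep [r] either contains [t^(g_1)],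
    which vanishes in the quotient, or is a product with at least [k] factors among the other
    generators. *)
Lemma ideal_pow_deepP k r : ideal_pow mx k (pib r) <-> deep_supp k r.
Proof.
split=> [/ideal_pow_deep[r' rr' kr']|/deep_decomp[u [ku ->]]].
  exact: pib_deep rr' kr'.
rewrite rmorph_sum; apply: ideal_gen_sum => s _; rewrite /= pi_scale.
have [->|/ku[u0|ku']] := eqVneq (val r)`_s 0.
- by rewrite scale0r; apply: ideal_gen0.
- by rewrite pib_tmon0 // scaler0; apply: ideal_gen0.
rewrite -mulr_algl; apply: ideal_genM; apply: ideal_pow_le ku' _.
exact: ideal_pow_tmon.
Qed.

(** * Lifting the presentation to the semigroup ring and the Rees algebra *)

Definition sg_exp c : 'I_e.+1 -> nat :=
  fun i => if unlift ord0 i is Some j then c j else 0%N.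

Lemma sg_exp0 c : sg_exp c ord0 = 0%N.
Proof. by rewrite /sg_exp unlift_none. Qed.

Lemma sg_exp_lift c j : sg_exp c (lift ord0 j) = c j.
Proof. by rewrite /sg_exp liftK. Qed.

Lemma sg_sum_exp c : sg_sum (sg_exp c) = mnm_val g' c.
Proof.
rewrite /sg_sum big_ord_recl sg_exp0 mul0n add0n.
by apply: eq_bigr => j _; rewrite sg_exp_lift.
Qed.

(** The degree [d] part of a polynomial evaluated at [t^(g_2), ..., t^(g_n)], before reduction
    modulo [t^(g_1)]. *)
Definition glift d : {mpoly K[e]} -> R :=
  mlin (fun c => if mdeg c == d then tmon (sg_exp c) else 0).
HB.instance Definition _ d := GRing.Linear.on (glift d).

Lemma gliftX d c : glift d 'X_[c] = if mdeg c == d then tmon (sg_exp c) else 0.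
Proof. exact: mlinX. Qed.

Lemma glift_coef d q s : (val (glift d q))`_s =
  \sum_(c <- msupp q | (mdeg c == d) && (s == mnm_val g' c)) q@_c.
Proof.
rewrite /glift /mlin val_sgring_sum coef_sum [RHS]big_mkcond.
apply: eq_bigr => c _.
rewrite val_sgringZ coefZ; case: eqP => [_|] /=; last by rewrite coef0 mulr0.
rewrite val_tmon sg_sum_exp coefXn; case: eqP => _; by rewrite ?mulr1 ?mulr0.
Qed.

Lemma glift_pihomog d d' q :
  glift d (pihomog mdeg d' q) = if d == d' then glift d q else 0.
Proof.
case: eqP => [->|dd'].
  apply: (@mpoly_lin_ext _ _ _ (glift d' \o pihomog mdeg d') (glift d')) => c /=.
  rewrite pihomog_mdegX gliftX; case: ifP => dc; last by rewrite linear0.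
  by rewrite gliftX dc.
apply: (@mpoly_lin_ext _ _ _ (glift d \o pihomog mdeg d') \0) => c /=.
rewrite pihomog_mdegX; case: eqP => dc; last by rewrite linear0.
by rewrite gliftX dc; case: eqP => // d'd; case: dd'.
Qed.

Local Notation A := (apery_gr K S).
Local Notation pig := (\pi_(gr_alg mx)).

Let trep (j : 'I_e) : rees mx := insubd (0 : rees mx) (tbar K (lift ord0 j) *: 'X^1).

Let val_trep j : val (trep j) = tbar K (lift ord0 j) *: 'X^1.
Proof.
rewrite /trep val_insubd ifT //; apply: rees_mon.
by apply/ideal_pow1/mbarP/ideal_genS; exists j.
Qed.

Lemma val_rees_sum (I : Type) (t : seq I) (F : I -> rees mx) :
  val (\sum_(i <- t) F i) = \sum_(i <- t) val (F i).
Proof. exact: rmorph_sum. Qed.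

Let val_trepX j k : val (trep j ^+ k) = (pib (tpow K (lift ord0 j) ^+ k))%:P * 'X^k.
Proof.
have -> : val (trep j ^+ k) = val (trep j) ^+ k by apply: rmorphXn.
by rewrite val_trep rmorphXn rmorphXn -mul_polyC exprMn expr1.
Qed.

Lemma val_rees_prod (I : Type) (t : seq I) (F : I -> rees mx) :
  val (\prod_(i <- t) F i) = \prod_(i <- t) val (F i).
Proof. exact: rmorph_prod. Qed.

(** Each variable lifts to [T] times the class of its power of [t], so a monomial of degree [d]
    lands in the coefficient of [T^d]. *)
Lemma apery_pres_glift q : exists2 p : rees mx, apery_pres q = pig p &
  forall d, (val p)`_d = pib (glift d q).
Proof.
pose p := \sum_(c <- msupp q) q@_c *: \prod_j trep j ^+ c j.
exists p.
  rewrite /apery_pres /mmap /p rmorph_sum; apply: eq_bigr => c _.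
  rewrite /= pi_scale mulr_algl; congr (_ *: _); rewrite /mmap1 rmorph_prod.
  by apply: eq_bigr => j _; rewrite rmorphXn.
move=> d; rewrite /p /glift /mlin val_rees_sum rmorph_sum coef_sum.
apply: eq_bigr => c _; rewrite -[RHS]/(pib (_ *: _)) pi_scale.
have -> : val (q@_c *: \prod_j trep j ^+ c j)
    = (q@_c)%:A *: ((pib (tmon (sg_exp c)))%:P * 'X^(mdeg c)).
  rewrite -[LHS]/(_ *: val (\prod_j trep j ^+ c j)); congr (_ *: _).
  rewrite val_rees_prod /tmon big_ord_recl sg_exp0 expr0 mul1r !rmorph_prod.
  rewrite mdegE -prodrXr -big_split; apply: eq_bigr => j _.
  by rewrite val_trepX sg_exp_lift.
rewrite coefZ coefCM coefXn eq_sym; case: eqP => _.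
  by rewrite mulr1 mulr_algl.
by rewrite !mulr0 rmorph0 scaler0.
Qed.

Lemma apery_pres_eq0 q :
  apery_pres q = 0 :> A <-> forall d, deep_supp d.+1 (glift d q).
Proof.
have [p -> pE] := apery_pres_glift q.
split=> [/quot_pi_eq0/gr_idealP mp d|dq].
  by apply/ideal_pow_deepP; rewrite -pE; apply: mp.
by apply/quot_pi_eq0/gr_idealP => d; rewrite pE; apply/ideal_pow_deepP.
Qed.

End AperyPresentation.

(** * Conclusion *)

Section AperyPresented.
Variables (K : fieldType) (S : numSemigroup).
Local Notation e := (nsg_e S).
Local Notation g := (@sgen S).
Local Notation g' := (fun j : 'I_e => g (lift ord0 j)).
Local Notation A := (apery_gr K S).
Local Notation mx := (@mbar K S).
Local Notation pib := (\pi_(sgring_bar K S)).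
Local Notation pig := (\pi_(gr_alg mx)).
Local Notation ap := (@apery_pres K S).

Lemma apery_pres_lrmorphism :
  exists f : {lrmorphism {mpoly K[e]} -> A}, f =1 ap.
Proof.
apply: lrmorphism_ex => [p q|p q||b p]; rewrite /apery_pres.
- exact: rmorphD.
- exact: rmorphM.
- exact: rmorph1.
- by rewrite mmapZ mulr_algl.
Qed.

Lemma glift_homog d i (q : {mpoly K[e]}) : q \is i.-homog -> d != i ->
  glift d q = 0.
Proof. by move=> /pihomog_dE <- di; rewrite glift_pihomog (negPf di). Qed.

Lemma apery_gpart i (x : A) : gpart i x <-> exists2 q, q \is i.-homog & x = ap q.
Proof.
split=> [[p p_i ->]|[q hq ->]]; last first.
  have [p -> pE] := apery_pres_glift q; exists p => // j ji.
  by rewrite pE (glift_homog hq ji) rmorph0.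
have /reesP/(_ i)/ideal_pow_deep[r rE kr] := valP p.
have [u [ku r_sum]] := deep_decomp kr.
(* Terms with a factor [t^(g_1)] or of order above [i] vanish in degree [i] of the associated graded
   algebra; the remaining ones are images of monomials of degree [i]. *)
pose top s := (u s ord0 == 0%N) && (sg_ord (u s) == i).
pose c s : 'X_{1..e} := [multinom u s (lift ord0 j) | j < e].
have dc s : mdeg (c s) = sg_ord (u s).
  by rewrite mdegE; apply: eq_bigr => j _; rewrite mnmE.
pose q : {mpoly K[e]} := \sum_(s < size (val r) | top s) (val r)`_s *: 'X_[c s].
have hq : q \is i.-homog.
  apply: rpred_sum => s /andP[_ /eqP di]; apply: rpredZ.
  by rewrite dhomogX; apply/eqP; rewrite -di -dc.
exists q => //; have [p' -> p'E] := apery_pres_glift q.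
apply/eqP; rewrite -Quotient.idealrBE; apply/gr_idealP => j.
have -> : (val (p - p'))`_j = (val p)`_j - (val p')`_j by rewrite -coefB.
rewrite p'E; have [->|ji] := eqVneq j i; last first.
  rewrite p_i // (glift_homog hq ji) rmorph0 subrr; exact: ideal_gen0.
have qE : glift i q = \sum_(s < size (val r) | top s) (val r)`_s *: tmon K (u s).
  rewrite /q linear_sum; apply: eq_bigr => s /andP[/eqP u0 /eqP ui].
  rewrite linearZ /= gliftX dc ui eqxx; congr (_ *: _).
  rewrite /tmon !big_ord_recl sg_exp0 u0; congr (_ * _).
  by apply: eq_bigr => j' _; rewrite sg_exp_lift mnmE.
rewrite rE -rmorphB; apply/ideal_pow_deepP; rewrite qE {1}r_sum.
rewrite (bigID (fun s : 'I__ => top s)) /=.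
rewrite addrAC subrr add0r big_mkcond; apply: deep_supp_sum => s.
rewrite /top; case: ifP => [ntop|_]; last exact: deep_supp0.
have [->|/ku[u0|ui]] := eqVneq (val r)`_s 0.
- by rewrite scale0r; apply: deep_supp0.
- by apply/deep_suppZ/deep_supp_tmon; left.
apply/deep_suppZ/deep_supp_tmon; move: ntop.
by have [_ /= iu|u0 _] := eqVneq (u s ord0) 0%N; [right|left]; lia.
Qed.

Lemma apery_presents (f : {lrmorphism {mpoly K[e]} -> A}) : f =1 ap ->
  presents f (fun q => ap q = 0).
Proof.
move=> fE; split=> [x|q|i x].
- rewrite -[x]reprK; move: (repr x) => p.
  have pE : p = \sum_(d < size (val p)) insubd (0 : rees mx) ((val p)`_d *: 'X^d).
    apply: val_inj; rewrite val_rees_sum -[LHS]coefK poly_def.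
    apply: eq_bigr => d _; rewrite val_insubd ifT //; apply: rees_mon.
    exact/reesP/(valP p).
  have /choice[q qE] : forall d, exists q, gr_class mx d (val p)`_d = f q.
    move=> d; have /apery_gpart[q _ qE] := gr_class_gpart mx d (val p)`_d.
    by exists q; rewrite fE.
  exists (\sum_(d < size (val p)) q d); rewrite {1}pE !rmorph_sum.
  by apply: eq_bigr => d _; apply: qE.
- by rewrite fE.
- by rewrite apery_gpart; split=> [[q hq ->]|[q hq ->]]; exists q; rewrite ?fE.
Qed.

Lemma sgen_inj : injective g.
Proof.
move=> i j gE; apply: val_inj.
by case: (ltngtP i j) => // /(@sgen_mono S); rewrite gE ltnn.
Qed.

Lemma apery_pres_homog d q : ap q = 0 -> ap (pihomog mdeg d q) = 0.
Proof.
move=> /apery_pres_eq0 q0; apply/apery_pres_eq0 => i; rewrite glift_pihomog.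
by case: eqP => _; [apply: q0|apply: deep_supp0].
Qed.

Lemma apery_pres_mon (c : 'X_{1..e}) :
  ap 'X_[c] = 0 <-> sg_deep S (mdeg c).+1 (mnm_val g' c).
Proof.
rewrite apery_pres_eq0; split=> [/(_ (mdeg c) (mnm_val g' c))|cd d s].
  by rewrite gliftX eqxx val_tmon sg_sum_exp coefXn eqxx oner_eq0; apply.
rewrite gliftX; case: (_ =P d) => [<-|_]; last by rewrite rmorph0 coef0 eqxx.
by rewrite val_tmon sg_sum_exp coefXn; case: (s =P _) => [->|]; rewrite ?eqxx.
Qed.

(** Consider the power of [t] given by the value of [c] in the lift of the part of [q] of degree
    [mdeg c]. If its coefficient survives, it is deep and [x^c] maps to zero; if it cancels, another
    monomial of [q] has the same degree and value, and the difference vanishes already in the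
    semigroup ring. *)
Lemma apery_pres_binomial q c : ap q = 0 -> c \in msupp q ->
  ap 'X_[c] = 0 \/ exists m, [/\ m <> c, mdeg m = mdeg c,
    mnm_val g' m = mnm_val g' c & ap ('X_[c] - 'X_[m]) = 0].
Proof.
move=> /apery_pres_eq0/(_ (mdeg c) (mnm_val g' c)) + cq.
rewrite glift_coef; set t := (X in X != 0) => td.
have [t0|/td cd] := eqVneq t 0; last by left; apply/apery_pres_mon.
right; apply: contrapT => none; move: t0 {td}; rewrite {}/t.
rewrite big_mkcond (bigD1_seq c) ?msupp_uniq //= !eqxx /=.
rewrite big_seq_cond big1 ?addr0 => [/eqP|m]; first by rewrite mcoeff_eq0 cq.
case/andP=> mq /eqP mc; case: ifP => // /andP[/eqP dm /eqP vm]; case: none.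
exists m; split=> //.
apply/apery_pres_eq0 => d; rewrite linearB /= !gliftX dm.
case: ifP => _; last by rewrite subr0; apply: deep_supp0.
move=> s.
have -> : val (tmon K (sg_exp c) - tmon K (sg_exp m))
  = val (tmon K (sg_exp c)) - val (tmon K (sg_exp m)) by [].
by rewrite !val_tmon !sg_sum_exp vm subrr coef0 eqxx.
Qed.

Lemma apery_pres_nil j : exists k, ap 'X_[U_(j) *+ k] = 0.
Proof.
(* With [h] the generator attached to [x_j], [(t^h)^(g_1) = (t^(g_1))^h] vanishes modulo
   [t^(g_1)]. *)
exists (g ord0); apply/apery_pres_mon; rewrite mnm_valXn.
exists (fun i => if i == ord0 then g (lift ord0 j) else 0%N).
  by rewrite /sg_sum big_ord_recl eqxx big1 ?addn0 1?mulnC.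
by left; rewrite eqxx sgen_gt0.
Qed.

Theorem apery_binSystem (j0 : 'I_e) : apery_complete_intersection K S ->
  exists (B : binSystem e) (f : {lrmorphism {mpoly K[e]} -> A}),
    presents f (bs_ideal B (bs_exp B (bs_var B))).
Proof.
case=> [[F genF] _]; have [f fE] := apery_pres_lrmorphism.
pose l := [arg max_(j > j0) g' j].
have l_max j : (g' j <= g' l)%N by rewrite /l; case: arg_maxnP => // i _; apply.
have g'_inj : injective g' by move=> i j /sgen_inj/lift_inj.
have g'_gt0 j : (0 < g' j)%N by apply: sgen_gt0.
have ap1 : ap 1 <> 0 by rewrite -fE rmorph1 => /eqP; rewrite oner_eq0.
have [B [Bl BE]] := binomial_ci_presentation g'_inj g'_gt0 l_max genF ap1
  apery_pres_homog apery_pres_binomial apery_pres_nil.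
exists B, f; rewrite Bl; have [fs f0 fg] := apery_presents fE.
by split=> // q; split=> [/f0/BE|/BE/f0].
Qed.

(** * The semigroup with a single generator *)

Fact trivial_binSystem_exp (i : 'I_1) : (0 < 1)%N. Proof. by []. Qed.

Definition trivial_binSystem : binSystem 1 :=
  @BinSystem 1 ord0 (fun=> 1%N) (fun=> None) (fun=> 1%N)
    trivial_binSystem_exp trivial_binSystem_exp
    (fun _ _ (h : None = Some _) => ltac:(by []))
    (fun _ _ (h : None = Some _) => ltac:(by [])).

Lemma trivial_bs_idealP (q : {mpoly K[1]}) :
  bs_ideal trivial_binSystem 1 q <-> q@_0%MM = 0.
Proof.
rewrite bs_idealP; have -> : nfp trivial_binSystem 1 q = q@_0%MM *: 1.
  rewrite [q]mpolyE !linear_sum scaler_suml; apply: eq_bigr => c _.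
  rewrite linearZ /= mcoeffZ -scalerA nfpX /nf_mon nf_reduced; last first.
    by move=> i; rewrite /reducible [i]ord1.
  rewrite mcoeffX ltnS leqn0 /=; congr (_ *: _).
  have -> : (c ord0 == 0%N) = (c == 0%MM).
    apply/eqP/eqP => [c0|->]; last by rewrite mnm0E.
    by apply/mnmP => i; rewrite [i]ord1 c0 mnm0E.
  by case: eqP => [->|_]; rewrite ?scale1r ?scale0r ?mpolyX0.
by split=> [/eqP|->]; rewrite ?scale0r // scaler_eq0 oner_eq0 orbF => /eqP.
Qed.

(* With a single generator [A = K] and its presentation has no variables; one
   variable is added and killed, since the Quotient Condition needs one. *)
Lemma apery_trivial_presents : e = 0%N ->
  exists f : {lrmorphism {mpoly K[1]} -> A},
    presents f (bs_ideal trivial_binSystem 1).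
Proof.
move=> e0; have [h hE] := apery_pres_lrmorphism.
have hC (q : {mpoly K[e]}) : h q = (q@_0%MM)%:A.
  by rewrite {1}(nvar0_mpolyC_eq q e0) -alg_mpolyC linearZ /= rmorph1.
have [hs _ hg] := apery_presents hE.
have [f fE] : exists f : {lrmorphism {mpoly K[1]} -> A}, f =1 fun q => (q@_0%MM)%:A.
  apply: lrmorphism_ex => [p q|p q||b p].
  - by rewrite mcoeffD scalerDl.
  - by rewrite rmorphM -scalerAl mul1r scalerA.
  - by rewrite mcoeff1 eqxx scale1r.
  - by rewrite mcoeffZ scalerA.
have homC i n (p : {mpoly K[n]}) m : p \is i.-homog ->
    (p@_0%MM)%:MP_[m] \is i.-homog.
  move=> /dhomogP hp; have [p0|nz] := eqVneq (p@_0%MM) 0.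
    by rewrite p0 mpolyC0 rpred0.
  have := hp 0%MM; rewrite mcoeff_msupp => /(_ nz) /= <-.
  by rewrite mdeg0 -alg_mpolyC rpredZ // dhomog1.
exists f; split=> [x|q|i x].
- have [q ->] := hs x; exists (q@_0%MM)%:MP.
  by rewrite fE hC mpolyCK.
- rewrite fE trivial_bs_idealP; split=> [/eqP|->]; last by rewrite scale0r.
  by rewrite scaler_eq0 oner_eq0 orbF => /eqP.
rewrite hg; split=> [[q hq ->]|[q hq ->]].
  exists (q@_0%MM)%:MP; first exact: homC hq.
  by rewrite hC fE mpolyCK.
exists (q@_0%MM)%:MP; first exact: homC hq.
by rewrite hC fE mpolyCK.
Qed.

End AperyPresented.

Lemma presents_quotient_condition (K : fieldType) (n : nat) (B : binSystem n)
    (A : gradedAlg K) (f : {lrmorphism {mpoly K[n]} -> A}) :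
  presents f (bs_ideal B (bs_exp B (bs_var B))) ->
  quotient_condition A /\
  exists (m : nat) (I : idealr {mpoly K[m]}) (l : 'I_m) (C : nat)
    (J : idealr (poly_alg I)), wlp_colon_quotient A l C J /\ monomial_ideal J.
Proof.
move=> fA; have [I [C [J [AJ monJ]]]] := presents_wlp_colon_quotient fA.
split; last by exists n, I, (bs_var B), C, J.
split; first exact: presents_std fA (bs_exp_gt0 _ _).
by exists n, I, (bs_var B), C, J.
Qed.

Theorem theorem4p12 (K : fieldType) (charK0 : [pchar K] =i pred0)
    (S : numSemigroup)
    (ciA : apery_complete_intersection K S) :
  quotient_condition (apery_gr K S) /\
  exists (m : nat) (I : idealr {mpoly K[m]}) (l : 'I_m) (C : nat)
    (J : idealr (poly_alg I)),
    wlp_colon_quotient (apery_gr K S) l C J /\ monomial_ideal J.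
Proof.
case: (posnP (nsg_e S)) => [e0|e_gt0].
  by have [f] := apery_trivial_presents K e0; apply: presents_quotient_condition.
have [B [f]] := apery_binSystem (Ordinal e_gt0) ciA.
exact: presents_quotient_condition.
Qed.
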